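(* Let $V$ be a Hilbert module over the Clifford algebra $\mathbb{R}_d$ and let $T\in\mathcal{K}(V)$ be bisectorial of angle $\omega\in(0,\frac{\pi}{2})$. Then $T$ is densely defined, and its adjoint $T^*\in\mathcal{K}(V)$ is also bisectorial of the same angle $\omega$.
   Context: Clifford algebra: for $d\in\mathbb{N}$, $d\ge1$, $\mathbb{R}_d$ is the real Clifford algebra generated by $e_1,\dots,e_d$ with $e_i^2=-1$, $e_ie_j=-e_je_i$ for $i\neq j$, with real basis $e_A=e_{i_1}\cdots e_{i_r}$, $A=(i_1,\dots,i_r)$, $1\le i_1<\dots<i_r\le d$, $e_\emptyset=1$. For $s=\sum_As_Ae_A$: $\overline{s}=\sum_A(-1)^{|A|(|A|+1)/2}s_Ae_A$, $|s|^2=\sum_As_A^2$. Paravectors: $\mathbb{R}^{d+1}=\{s_0+s_1e_1+\dots+s_de_d\mid s_j\in\mathbb{R}\}$. Hilbert module: for a real Hilbert space $V_\mathbb{R}$, $V=\{\sum_Av_A\otimes e_A\mid v_A\in V_\mathbb{R}\}$ with $\|v\|^2=\sum_A\|v_A\|_\mathbb{R}^2$, $sv=\sum_{A,B}(s_Bv_A)\otimes(e_Be_A)$, $vs=\sum_{A,B}(v_As_B)\otimes(e_Ae_B)$, $\langle v,w\rangle=\sum_{A,B}\langle v_A,w_B\rangle_\mathbb{R}\overline{e_A}e_B$. $\mathcal{B}(V)$: bounded everywhere defined right-linear operators; $\mathcal{K}(V)$: closed right-linear operators $T:\operatorname{dom}(T)\subseteq V\to V$ (domain a right submodule). The adjoint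 of a densely defined right-linear $T$ has $\operatorname{dom}(T^* )=\{w\in V\mid\exists v_w\in V:\langle v_w,v\rangle=\langle w,Tv\rangle\ \forall v\in\operatorname{dom}(T)\}$, $T^*w=v_w$. Clifford numbers act on operators by left multiplication: $(Ts)v=T(sv)$. $S$-spectrum: for $s\in\mathbb{R}^{d+1}$, $Q_s[T]=T^2-2s_0T+|s|^2$ on $\operatorname{dom}(T^2)$, $\rho_S(T)=\{s\in\mathbb{R}^{d+1}\mid Q_s[T]^{-1}\in\mathcal{B}(V)\}$, $\sigma_S(T)=\mathbb{R}^{d+1}\setminus\rho_S(T)$, and $S_L^{-1}(s,T)=Q_s[T]^{-1}\overline{s}-TQ_s[T]^{-1}$ for $s\in\rho_S(T)$. Double sector: for $\omega\in(0,\frac{\pi}{2})$, $D_\omega=\{s\in\mathbb{R}^{d+1}\setminus\{0\}\mid\operatorname{Arg}(s)\in I_\omega\}$ with $I_\omega=(-\omega,\omega)\cup(\pi-\omega,\pi+\omega)$, where $\operatorname{Arg}(s)=\arccos(s_0/|s|)\in[0,\pi]$. Bisectorial: $T\in\mathcal{K}(V)$ is bisectorial of angle $\omega\in(0,\frac{\pi}{2})$ if $\sigma_S(T)\subseteq\overline{D_\omega}$ and for every $\varphi\in(\omega,\frac{\pi}{2})$ there exists $C_\varphi\ge0$ such that $\|S_L^{-1}(s,T)\|\le\frac{C_\varphi}{|s|}$ for all $s\in\mathbb{R}^{d+1}\setminus(D_\varphi\cup\{0\})$. *)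

(* Defs.v *)
From HB Require Import structures.
From mathcomp Require Import all_boot all_order all_algebra.
From mathcomp Require Import ring.
From mathcomp Require Import all_classical all_reals all_analysis.
Set Implicit Arguments.
Unset Strict Implicit.
Unset Printing Implicit Defensive.
Import Order.TTheory GRing.Theory Num.Theory.
Import numFieldNormedType.Exports.
Local Open Scope classical_set_scope.
Local Open Scope ring_scope.

(* A Clifford number is given by its coefficients s A in the basis e_A, where
   the generators e_1, ..., e_d are indexed from 0, by 'I_d. *)
Definition clifford (R : comNzRingType) (d : nat) := {ffun {set 'I_d} -> R}.

Section CliffordAlgebra.
Context (R : comNzRingType) (d : nat).
Local Notation cl := (clifford R d).
Implicit Types (A B C : {set 'I_d}) (s t u : cl).

HB.instance Definition _ :=
  GRing.Lmodule.copy cl ({ffun {set 'I_d} -> R^o} : lmodType R).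

Definition cbasis A : cl := [ffun B => (B == A)%:R].

Definition cgen (i : 'I_d) : cl := cbasis [set i]%SET.

Definition symdiff A B : {set 'I_d} := ((A :\: B) :|: (B :\: A))%SET.

(* Sorting the word e_A e_B costs one sign for each pair i in A, j in B with
   j < i, and each i in A :&: B then contributes e_i^2 = -1. *)
Definition swaps A B : nat :=
  (\sum_(i in A) \sum_(j in B) (j <= i)%N)%N.

Definition cmul s t : cl :=
  \sum_A \sum_B ((-1) ^+ swaps A B * (s A * t B)) *: cbasis (symdiff A B).

Lemma sum_swap A B (f : 'I_d -> nat) :
  (-1) ^+ (\sum_(i in symdiff A B) f i)%N =
  (-1) ^+ (\sum_(i in A) f i)%N * (-1) ^+ (\sum_(i in B) f i)%N :> R.
Proof.
rewrite -exprD [X in (X + _)%N](big_setID B)/= [X in (_ + X)%N](big_setID A)/=.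
rewrite (finset.setIC B A) addnACA addnn exprD -mul2n exprM sqrrN !expr1n.
rewrite mul1r; congr (_ ^+ _).
rewrite [LHS]big_mkcond [X in (X + _)%N]big_mkcond [X in (_ + X)%N]big_mkcond.
rewrite -big_split/=; apply: eq_bigr => i _.
by rewrite !inE; case: (i \in A); case: (i \in B) => //=; rewrite addn0.
Qed.

Lemma swaps_symdiffl A B C :
  (-1) ^+ swaps (symdiff A B) C = (-1) ^+ swaps A C * (-1) ^+ swaps B C :> R.
Proof. exact: sum_swap. Qed.

Lemma swaps_symdiffr A B C :
  (-1) ^+ swaps A (symdiff B C) = (-1) ^+ swaps A B * (-1) ^+ swaps A C :> R.
Proof.
by rewrite /swaps exchange_big/= sum_swap; congr (_ ^+ _ * _ ^+ _);
  rewrite exchange_big.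
Qed.

Lemma symdiffA : associative symdiff.
Proof.
move=> A B C; apply/setP => i; rewrite !inE.
by case: (i \in A); case: (i \in B); case: (i \in C).
Qed.

Lemma symdiff0l : left_id finset.set0 symdiff.
Proof. by move=> A; rewrite /symdiff finset.set0D finset.setD0 finset.set0U. Qed.

Lemma symdiff0r : right_id finset.set0 symdiff.
Proof. by move=> A; rewrite /symdiff finset.set0D finset.setD0 finset.setU0. Qed.

Lemma cbasis_sum s : s = \sum_A s A *: cbasis A.
Proof.
apply/ffunP => B; rewrite sum_ffunE (bigD1 B)//= big1 ?addr0.
  by rewrite !ffunE eqxx; exact/esym/mulr1.
by move=> A /negPf nAB; rewrite !ffunE eq_sym nAB; exact: mulr0.
Qed.

Lemma cmulDl : left_distributive cmul +%R.
Proof.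
move=> s t u; rewrite /cmul -big_split/=; apply: eq_bigr => A _.
rewrite -big_split/=; apply: eq_bigr => B _.
by rewrite !ffunE mulrDl mulrDr scalerDl.
Qed.

Lemma cmulDr : right_distributive cmul +%R.
Proof.
move=> s t u; rewrite /cmul -big_split/=; apply: eq_bigr => A _.
rewrite -big_split/=; apply: eq_bigr => B _.
by rewrite !ffunE !mulrDr scalerDl.
Qed.

Lemma cmulZl a s t : cmul (a *: s) t = a *: cmul s t.
Proof.
rewrite /cmul scaler_sumr; apply: eq_bigr => A _.
rewrite scaler_sumr; apply: eq_bigr => B _.
by rewrite scalerA ffunE -mulrA mulrCA.
Qed.

Lemma cmulZr a s t : cmul s (a *: t) = a *: cmul s t.
Proof.
rewrite /cmul scaler_sumr; apply: eq_bigr => A _.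
rewrite scaler_sumr; apply: eq_bigr => B _.
by rewrite scalerA ffunE; congr (_ *: _); rewrite [RHS]mulrCA; congr (_ * _); exact: mulrCA.
Qed.

Lemma cmul0l s : cmul 0 s = 0.
Proof. by rewrite -(scale0r 0) cmulZl !scale0r. Qed.

Lemma cmul0r s : cmul s 0 = 0.
Proof. by rewrite -(scale0r 0) cmulZr !scale0r. Qed.

Lemma cmul_suml I (r : seq I) (F : I -> cl) t :
  cmul (\sum_(i <- r) F i) t = \sum_(i <- r) cmul (F i) t.
Proof. exact: (big_morph (cmul^~ t) (fun x y => cmulDl x y t) (cmul0l t)). Qed.

Lemma cmul_sumr I (r : seq I) (F : I -> cl) s :
  cmul s (\sum_(i <- r) F i) = \sum_(i <- r) cmul s (F i).
Proof. exact: (big_morph (cmul s) (cmulDr s) (cmul0r s)). Qed.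

Lemma cmul_basis A B :
  cmul (cbasis A) (cbasis B) = (-1) ^+ swaps A B *: cbasis (symdiff A B).
Proof.
rewrite /cmul (bigD1 A)//= [X in _ + X]big1 ?addr0; last first.
  move=> A' /negPf nA; apply: big1 => B' _.
  by rewrite !ffunE nA mul0r mulr0 scale0r.
rewrite (bigD1 B)//= [X in _ + X]big1 ?addr0; last first.
  by move=> B' /negPf nB; rewrite !ffunE nB !mulr0 scale0r.
by rewrite !ffunE !eqxx !mulr1.
Qed.

Lemma cmulA : associative cmul.
Proof.
have H A B C : cmul (cbasis A) (cmul (cbasis B) (cbasis C)) =
    cmul (cmul (cbasis A) (cbasis B)) (cbasis C).
  rewrite !cmul_basis cmulZl cmulZr !cmul_basis !scalerA symdiffA.
  rewrite swaps_symdiffl swaps_symdiffr mulrCA; congr (_ * _ *: _).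
  exact: mulrC.
move: H cmulZl cmulZr cmul_suml cmul_sumr.
move: cmul => m H mZl mZr m_suml m_sumr s t u.
rewrite (cbasis_sum s) !m_suml; apply: eq_bigr => A _.
rewrite !mZl; congr (_ *: _).
rewrite (cbasis_sum t) !(m_suml, m_sumr); apply: eq_bigr => B _.
rewrite !(mZl, mZr); congr (_ *: _).
rewrite (cbasis_sum u) !m_sumr; apply: eq_bigr => C _.
by rewrite !mZr H.
Qed.

Lemma cmul1l : left_id (cbasis finset.set0) cmul.
Proof.
move=> s; rewrite [in LHS](cbasis_sum s) cmul_sumr [RHS]cbasis_sum.
apply: eq_bigr => A _.
by rewrite cmulZr cmul_basis symdiff0l /swaps big_set0 expr0 scale1r.
Qed.

Lemma cmul1r : right_id (cbasis finset.set0) cmul.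
Proof.
move=> s; rewrite [in LHS](cbasis_sum s) cmul_suml [RHS]cbasis_sum.
apply: eq_bigr => A _; rewrite cmulZl cmul_basis symdiff0r /swaps.
by rewrite big1 ?expr0 ?scale1r// => i _; rewrite big_set0.
Qed.

Lemma cone_neq0 : cbasis finset.set0 != 0.
Proof.
by apply/eqP => /ffunP/(_ finset.set0)/eqP; rewrite !ffunE eqxx oner_eq0.
Qed.

HB.instance Definition _ := GRing.Zmodule_isNzRing.Build cl
  cmulA cmul1l cmul1r cmulDl cmulDr cone_neq0.
HB.instance Definition _ := GRing.Lmodule_isLalgebra.Build R cl
  (fun a s t => esym (cmulZl a s t)).
HB.instance Definition _ := GRing.Lalgebra_isAlgebra.Build R cl
  (fun a s t => esym (cmulZr a s t)).

Lemma cgen_mul i j : cgen i * cgen j =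
  (-1) ^+ (j <= i)%N *: cbasis (symdiff [set i]%SET [set j]%SET).
Proof. by rewrite [LHS]cmul_basis /swaps !big_set1. Qed.

Lemma cgen_sqr i : cgen i * cgen i = -1.
Proof.
rewrite cgen_mul leqnn expr1 scaleN1r.
by rewrite /symdiff finset.setDv finset.setU0.
Qed.

Lemma cgen_anticomm i j : i != j -> cgen i * cgen j = - (cgen j * cgen i).
Proof.
move=> nij; rewrite !cgen_mul.
have -> : symdiff [set j]%SET [set i]%SET = symdiff [set i]%SET [set j]%SET.
  by rewrite /symdiff finset.setUC.
rewrite -scaleNr; congr (_ *: _).
have := nij; rewrite -val_eqE/=; case: ltngtP => // _ _.
by rewrite expr0 expr1 opprK.
Qed.

Lemma cbasis_prod A : cbasis A = \prod_(i in A) cgen i.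
Proof.
have H (r : seq 'I_d) : sorted ltn (map val r) ->
    \prod_(i <- r) cgen i = cbasis [set i in r]%SET.
  elim: r => [_|i r IHr] /=.
    by rewrite big_nil; congr cbasis; apply/setP => i; rewrite !inE.
  rewrite path_sortedE; last exact: ltn_trans.
  move=> /andP[/allP ir /IHr{}IHr]; rewrite big_cons IHr [LHS]cmul_basis.
  have lt_ir j : j \in r -> (i < j)%N by move=> jr; apply: ir; exact: map_f.
  rewrite /swaps big_set1 big1 ?expr0 ?scale1r; last first.
    by move=> j; rewrite inE leqNgt => /lt_ir ->.
  congr cbasis; apply/setP => j; rewrite !inE.
  have [->|_] /= := eqVneq j i; last by rewrite andbF.
  by rewrite andbT orbF; apply/negP => /lt_ir; rewrite ltnn.
rewrite -[RHS]big_filter [index_enum _]unlock -enumT H.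
  by congr cbasis; apply/setP => i; rewrite !inE mem_filter mem_enum andbT.
rewrite sorted_map; apply: sorted_filter.
  by move=> ? ? ?; exact: ltn_trans.
by have := iota_ltn_sorted 0 d; rewrite -val_enum_ord sorted_map.
Qed.

Definition cconj s : clifford R d :=
  \sum_(A : {set 'I_d}) ((-1) ^+ (#|A| * #|A|.+1)./2 * s A) *: cbasis A.

End CliffordAlgebra.

Definition cabs (R : realType) (d : nat) (s : clifford R d) : R :=
  Num.sqrt (\sum_A s A ^+ 2).

(* A paravector s_0 + s_1 e_1 + ... + s_d e_d is stored as the row vector
   (s_0, ..., s_d).  The library norm on 'rV is the sup norm, so the Clifford
   modulus |s| is always written cabs (para s); the two induce the same
   topology. *)
Notation paravector R d := 'rV[R]_d.+1.

Definition para (R : comNzRingType) (d : nat) (s : paravector R d) :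
    clifford R d :=
  s 0 ord0 *: 1 + \sum_(i < d) s 0 (lift ord0 i) *: cgen R i.

HB.mixin Record NormedModule_isHilbert (R : realType) V & NormedModule R V := {
  inner : {dot V for idfun};
  inner_norm : forall v, inner v v = `|v| ^+ 2
}.

#[short(type="hilbertType")]
HB.structure Definition Hilbert (R : realType) :=
  {V of CompleteNormedModule R V & NormedModule_isHilbert R V}.

(* V = VR (x) R_d; the vector \sum_A v_A (x) e_A is given by its
   components v A. *)
Definition hmodule (d : nat) (V : Type) := {ffun {set 'I_d} -> V}.

Section HilbertModuleNorm.
Context (R : realType) (d : nat) (VR : normedModType R).
Local Notation V := (hmodule d VR).
Implicit Types (v w : V).

HB.instance Definition _ :=
  GRing.Lmodule.copy V ({ffun {set 'I_d} -> VR} : lmodType R).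

Definition hnorm v : R := Num.sqrt (\sum_A `|v A| ^+ 2).

Lemma cauchy_schwarz_sum (I : finType) (a b : I -> R) :
  \sum_i a i * b i <=
  Num.sqrt (\sum_i a i ^+ 2) * Num.sqrt (\sum_i b i ^+ 2).
Proof.
set x := Num.sqrt (\sum_i a i ^+ 2); set y := Num.sqrt (\sum_i b i ^+ 2).
have xE : x ^+ 2 = \sum_i a i ^+ 2.
  by rewrite sqr_sqrtr// sumr_ge0// => i _; exact: sqr_ge0.
have yE : y ^+ 2 = \sum_i b i ^+ 2.
  by rewrite sqr_sqrtr// sumr_ge0// => i _; exact: sqr_ge0.
have zero (c e : I -> R) : \sum_i c i ^+ 2 = 0 -> \sum_i c i * e i = 0.
  move=> /eqP; rewrite psumr_eq0 => [/allP c0|i _]; last exact: sqr_ge0.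
  apply: big1 => i _; have := c0 i (mem_index_enum i).
  by rewrite /= sqrf_eq0 => /eqP->; rewrite mul0r.
have [x0|x0] := eqVneq x 0.
  by rewrite x0 mul0r zero// -xE x0 expr0n.
have [y0|y0] := eqVneq y 0.
  under eq_bigr do rewrite mulrC.
  by rewrite y0 mulr0 zero// -yE y0 expr0n.
have xy0 : 0 < x * y by rewrite mulr_gt0// lt_neqAle eq_sym ?x0 ?y0 sqrtr_ge0.
have : 0 <= \sum_i (y * a i - x * b i) ^+ 2.
  by apply: sumr_ge0 => i _; exact: sqr_ge0.
have -> : \sum_i (y * a i - x * b i) ^+ 2 =
    (x * y) * (2 * (x * y - \sum_i a i * b i)).
  transitivity (y ^+ 2 * (\sum_i a i ^+ 2) - 2 * (x * y) * (\sum_i a i * b i)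
      + x ^+ 2 * (\sum_i b i ^+ 2)).
    rewrite !mulr_sumr -sumrB -big_split/=; apply: eq_bigr => i _; ring.
  rewrite -xE -yE; ring.
by rewrite pmulr_rge0// pmulr_rge0// subr_ge0.
Qed.

Lemma hnormD v w : hnorm (v + w) <= hnorm v + hnorm w.
Proof.
have ge0 (u : V) : 0 <= \sum_A `|u A| ^+ 2.
  by apply: sumr_ge0 => A _; exact: sqr_ge0.
rewrite -[leRHS]ger0_norm ?addr_ge0 ?sqrtr_ge0// -sqrtr_sqr ler_sqrt ?sqr_ge0//.
rewrite sqrrD !sqr_sqrtr//.
apply: (@le_trans _ _ (\sum_A (`|v A| + `|w A|) ^+ 2)).
  by apply: ler_sum => A _; rewrite ffunE lerXn2r ?nnegrE ?addr_ge0// ler_normD.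
under eq_bigr do rewrite sqrrD.
rewrite !big_split/= lerD2r lerD2l -mulr2n lerMn2r/=.
exact: (cauchy_schwarz_sum (fun A => `|v A|) (fun A => `|w A|)).
Qed.

Lemma hnormZ a v : hnorm (a *: v) = `|a| * hnorm v.
Proof.
rewrite /hnorm -[X in X * _]ger0_norm// -sqrtr_sqr -sqrtrM ?sqr_ge0//.
by rewrite mulr_sumr; under eq_bigr do rewrite ffunE normrZ exprMn.
Qed.

Lemma hnorm0_eq0 v : hnorm v = 0 -> v = 0.
Proof.
move=> /eqP; rewrite sqrtr_eq0 => le0; apply/ffunP => A; rewrite ffunE.
have ge0 (B : {set 'I_d}) : 0 <= `|v B| ^+ 2 by exact: sqr_ge0.
have /eqP : \sum_B `|v B| ^+ 2 = 0 by apply/eqP; rewrite eq_le le0 sumr_ge0.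
rewrite psumr_eq0// => /allP/(_ A (mem_index_enum A)).
by rewrite /= sqrf_eq0 normr_eq0 => /eqP.
Qed.

HB.instance Definition _ :=
  Lmodule_isNormed.Build R V hnormD hnormZ hnorm0_eq0.

End HilbertModuleNorm.

Section CliffordActions.
Context (R : realType) (d : nat).

Definition tensor (VR : normedModType R) (x : VR) (s : clifford R d) :
  hmodule d VR := [ffun A => s A *: x].

Definition lmulc (VR : normedModType R) (s : clifford R d) (v : hmodule d VR) :
    hmodule d VR :=
  \sum_A \sum_B tensor (s B *: v A) (cbasis R B * cbasis R A).

Definition rmulc (VR : normedModType R) (v : hmodule d VR) (s : clifford R d) :
    hmodule d VR :=
  \sum_A \sum_B tensor (s B *: v A) (cbasis R A * cbasis R B).

Definition cinner (VR : hilbertType R) (v w : hmodule d VR) : clifford R d :=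
  \sum_A \sum_B inner (v A) (w B) *: (cconj (cbasis R A) * cbasis R B).

End CliffordActions.

(* A partial operator; the values outside the domain are irrelevant. *)
Record operator (V : Type) := Operator { dom : set V; opfun :> V -> V }.

Definition opcomp (V : Type) (S T : operator V) : operator V :=
  Operator [set v | dom T v /\ dom S (T v)] (fun v => S (T v)).

Definition opsub (V : zmodType) (S T : operator V) : operator V :=
  Operator (dom S `&` dom T) (fun v => S v - T v).

Definition opinjective (V : Type) (T : operator V) : Prop :=
  forall v w, dom T v -> dom T w -> T v = T w -> v = w.

(* The inverse, with domain the range of T; meaningful for injective T. *)
Definition opinv (V : pointedType) (T : operator V) : operator V :=
  Operator [set T v | v in dom T]
    (fun w => xget point [set v | dom T v /\ T v = w]).

Definition opnorm (R : realType) (V : normedModType R) (T : operator V) :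
    \bar R :=
  ereal_sup [set (`|T v|)%:E | v in [set v | dom T v /\ `|v| <= 1]].

Section Operators.
Context (R : realType) (d : nat) (VR : hilbertType R).
Local Notation V := (hmodule d VR).
Implicit Types (T : operator V) (s : paravector R d).

Definition right_linear T : Prop :=
  [/\ dom T 0,
      forall v w, dom T v -> dom T w ->
        dom T (v + w) /\ T (v + w) = T v + T w &
      forall v (a : clifford R d), dom T v ->
        dom T (rmulc v a) /\ T (rmulc v a) = rmulc (T v) a].

Definition bounded_operator T : Prop :=
  [/\ right_linear T, dom T = setT & (opnorm T < +oo)%E].

Definition closed_operator T : Prop :=
  right_linear T /\ closed [set p : V * V | dom T p.1 /\ T p.1 = p.2].

(* T* w = v_w is uniquely determined when T is densely defined. *)
Definition adjoint T : operator V :=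
  let adj w z := forall v, dom T v -> cinner z v = cinner w (T v) in
  Operator [set w | exists z, adj w z] (fun w => xget 0 [set z | adj w z]).

Definition opmulc T (a : clifford R d) : operator V :=
  Operator [set v | dom T (lmulc a v)] (fun v => T (lmulc a v)).

Definition Qop s T : operator V :=
  Operator (dom (opcomp T T))
    (fun v => T (T v) - (2 * s 0 ord0) *: T v + cabs (para s) ^+ 2 *: v).

Definition S_resolvent_set T : set (paravector R d) :=
  [set s | opinjective (Qop s T) /\ bounded_operator (opinv (Qop s T))].

Definition S_spectrum T : set (paravector R d) := ~` S_resolvent_set T.

Definition left_S_resolvent s T : operator V :=
  opsub (opmulc (opinv (Qop s T)) (cconj (para s)))
        (opcomp T (opinv (Qop s T))).

Definition Arg s : R := acos (s 0 ord0 / cabs (para s)).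

Definition double_sector (omega : R) : set (paravector R d) :=
  [set s | s != 0 /\
    ([set` `]- omega, omega[ ] `|` [set` `]pi - omega, pi + omega[ ]) (Arg s)].

Definition bisectorial (omega : R) T : Prop :=
  [/\ closed_operator T,
      S_spectrum T `<=` closure (double_sector omega) &
      forall phi, omega < phi < pi / 2 ->
        exists2 C : R, 0 <= C &
          forall s, ~ (double_sector phi `|` [set 0]) s ->
            (opnorm (left_S_resolvent s T) <= (C / cabs (para s))%:E)%E].

End Operators.

(* Main.v *)
Require Import Defs.
From HB Require Import structures.
From mathcomp Require Import all_boot all_order all_algebra.
From mathcomp Require Import ring lra.
From mathcomp Require Import all_classical all_reals all_analysis.
Set Implicit Arguments.
Unset Strict Implicit.
Unset Printing Implicit Defensive.
Import Order.TTheory GRing.Theory Num.Theory.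
Import numFieldNormedType.Exports.
Local Open Scope classical_set_scope.
Local Open Scope ring_scope.

(** The Clifford structure enters only through real Hilbert space theory.  The
    scalar part of the Clifford-valued product is a real inner product, under
    which V is a Hilbert space (the sum of copies of VR indexed by the e_A) and
    left and right multiplication by a Clifford number a have left and right
    multiplication by the conjugate of a as adjoints ([inner_lmulc],
    [inner_rmulc]).  The other components of <z, v> are the scalar parts of
    products <z, va> ([cinner_coord]), so for a right-linear operator the
    Clifford adjoint T^* is its real Hilbert space adjoint ([cinner_adjP]).

    Let s lie outside a double sector D_phi, phi > omega, s <> 0, and write
    s = s_0 + x with x the vector part, and B = Q_s[T]^-1.  The conjugate of s
    has the same Q_s and the same argument, so half the sum and half the
    difference of the two left S-resolvents give
      |s_0 B v - T B v| <= (C / |s|) |v|   and   |x| |B v| <= (C / |s|) |v|,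
    the second one because left multiplication by x is |x| times an isometry
    ([Qinv_split_bounds]).

    Density.  For purely imaginary s with |s| = n these bounds decompose each v
    as v = T w + u with w = T B v, u = n^2 B v, both w and u in dom(T),
    |w| <= C |v| / n and |u| <= C |v|.  If v is orthogonal to dom(T), a weak
    limit of the u must be v, since T is closed and w tends to 0; but all u are
    orthogonal to v, so v = 0.  Weak compactness is replaced by
    the convergence of almost minimal elements of nested bounded convex sets
    ([nested_midconvex_cvg], [dense_dom_of_vanishing_preimages]).

    Adjoint.  B and T B are bounded, hence have bounded adjoints A and N.  As B
    commutes with T on dom(T), one finds T^* A = N and that A inverts Q_s[T^*]
    ([Qinv_adjoint]).  The left S-resolvent of T^* at s is therefore the adjoint
    of s B - T B = (s_0 B - T B) + x B, of norm at most 2 C / |s|.  The inclusion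
    of the spectrum follows, because each point outside the closure of D_omega
    also lies outside some D_phi with phi > omega ([sector_escape]). *)

(** * Geometry of real Hilbert spaces *)

Section HilbertGeometry.
Context {R : realType} {H : hilbertType R}.
Implicit Types (x y z v w : H) (a c : R).

Lemma innerC x y : inner x y = inner y x.
Proof. by rewrite hermC expr0 mul1r. Qed.

Lemma innerDl x y z : inner (x + y) z = inner x z + inner y z.
Proof. by rewrite linearDl. Qed.

Lemma innerDr x y z : inner x (y + z) = inner x y + inner x z.
Proof. by rewrite linearDr. Qed.

Lemma innerZl a x y : inner (a *: x) y = a * inner x y.
Proof. by rewrite linearZl_LR. Qed.

Lemma innerZr a x y : inner x (a *: y) = a * inner x y.
Proof. by rewrite linearZr_LR. Qed.

Lemma innerNl x y : inner (- x) y = - inner x y.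
Proof. by rewrite linearNl. Qed.

Lemma innerNr x y : inner x (- y) = - inner x y.
Proof. by rewrite linearNr. Qed.

Lemma inner0l x : inner 0 x = 0.
Proof. by rewrite linear0l. Qed.

Lemma inner0r x : inner x 0 = 0.
Proof. by rewrite linear0r. Qed.

Lemma inner_self_eq0 x : inner x x = 0 -> x = 0.
Proof. by rewrite inner_norm => /eqP; rewrite sqrf_eq0 normr_eq0 => /eqP. Qed.

Lemma inner_eql x y : (forall v, inner x v = inner y v) -> x = y.
Proof.
move=> xy; apply/subr0_eq/inner_self_eq0.
by rewrite innerDl innerNl xy subrr.
Qed.

Lemma norm_sqrD x y : `|x + y| ^+ 2 = `|x| ^+ 2 + 2 * inner x y + `|y| ^+ 2.
Proof.
by rewrite -!inner_norm innerDl !innerDr (innerC y x); ring.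
Qed.

Lemma inner_abs_le x y : `|inner x y| <= `|x| * `|y|.
Proof.
have [->|y0] := eqVneq y 0; first by rewrite inner0r !normr0 mulr0.
have n0 : 0 < `|y| by rewrite normr_gt0.
rewrite -(@ler_pXn2r _ 2)// ?nnegrE ?mulr_ge0// real_normK ?num_real//.
have : 0 <= `|x + (- (inner x y / `|y| ^+ 2)) *: y| ^+ 2 by exact: sqr_ge0.
rewrite norm_sqrD innerZr normrZ exprMn real_normK ?num_real//.
set p := inner x y; have -> : `|x| ^+ 2 + 2 * (- (p / `|y| ^+ 2) * p) +
  (- (p / `|y| ^+ 2)) ^+ 2 * `|y| ^+ 2 = `|x| ^+ 2 - p ^+ 2 / `|y| ^+ 2.
  by field; rewrite gt_eqF.
by rewrite subr_ge0 ler_pdivrMr ?exprn_gt0// exprMn.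
Qed.

Lemma parallelogram x y :
  `|x - y| ^+ 2 = 2 * `|x| ^+ 2 + 2 * `|y| ^+ 2 - 4 * `|2^-1 *: (x + y)| ^+ 2.
Proof.
rewrite normrZ exprMn real_normK ?num_real// !norm_sqrD innerNr normrN.
by field.
Qed.

(** A strongly convergent substitute for weak compactness.  Let m_n be the
    infimum of the squared norm on K_n; these increase and are bounded.  If u_n
    in K_n nearly attains m_n then, for i, j >= k, the midpoint of u_i and u_j
    is in K_k, so the parallelogram law bounds |u_i - u_j|^2 by the oscillation
    of m from k on. *)
Lemma nested_midconvex_cvg (K : nat -> set H) (M : R) :
  (forall n, K n !=set0) ->
  (forall n m, (n <= m)%N -> K m `<=` K n) ->
  (forall n x y, K n x -> K n y -> K n (2^-1 *: (x + y))) ->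
  (forall n x, K n x -> `|x| <= M) ->
  exists (u : nat -> H) (l : H), (forall n, K n (u n)) /\ u @ \oo --> l.
Proof.
move=> K0 Kdecr Kmid KM.
pose N n : set R := [set `|x| ^+ 2 | x in K n].
pose m n := inf (N n).
have Ninf n : has_inf (N n).
  split; first by have [x Kx] := K0 n; exists (`|x| ^+ 2), x.
  by exists 0 => _ [x _ <-]; exact: sqr_ge0.
have mle n x : K n x -> m n <= `|x| ^+ 2.
  by move=> Kx; apply: ge_inf; [have [] := Ninf n|exists x].
have /choice[u uP] : forall n, exists x, K n x /\ `|x| ^+ 2 < m n + n.+1%:R^-1.
  move=> n; have e0 : 0 < n.+1%:R^-1 :> R by rewrite invr_gt0.
  have [_ [x Kx <-] xlt] := inf_adherent e0 (Ninf n).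
  by exists x.
have mM n : m n <= M ^+ 2.
  have [x Kx] := K0 n; apply: (le_trans (mle _ _ Kx)).
  by rewrite lerXn2r ?nnegrE// ?(KM _ _ Kx)// (le_trans _ (KM _ _ Kx)).
have mincr : nondecreasing_seq m.
  move=> n k nk; apply: lb_le_inf; first by have [] := Ninf k.
  by move=> _ [x /(Kdecr _ _ nk) Kx <-]; exact: mle.
have mcvg : m @ \oo --> sup (range m).
  apply: nondecreasing_cvgn => //; exists (M ^+ 2) => _ [n _ <-]; exact: mM.
have near_m (e : R) : 0 < e -> \forall n \near \oo, sup (range m) - e < m n.
  move=> e0; have /cvgrPdist_lt/(_ e e0) := mcvg.
  by apply: filterS => n; rewrite ltr_norml => /andP[_]; lra.
have m_sup n : m n <= sup (range m).
  apply: ub_le_sup; last by exists n.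
  by exists (M ^+ 2) => _ [k _ <-]; exact: mM.
have ucauchy : cauchy (u @ \oo).
  apply/cauchy_ballP; suff ball_near (e : R) :
    0 < e -> \forall x & y \near u @ \oo, ball x e y by [].
  move=> e0; near_simpl.
  (* Each |u_i|^2 is within 2 r of m_k, which gives |u_i - u_j|^2 < 8 r. *)
  have [r r0 re] : exists2 r : R, 0 < r & e ^+ 2 = 8 * r.
    exists (e ^+ 2 / 8); first by rewrite divr_gt0// exprn_gt0.
    by rewrite mulrC divfK.
  have [k _ /(_ _ (leqnn _))/=[mk ik]] :
      \forall n \near \oo, sup (range m) - r < m n /\ n.+1%:R^-1 < r.
    apply: filterI; first exact: near_m.
    exact: near_infty_natSinv_lt (PosNum r0).
  have close n : (k <= n)%N -> K k (u n) /\ `|u n| ^+ 2 < m k + 2 * r.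
    move=> kn; have [Kn un] := uP n; split; first exact: (Kdecr _ _ kn).
    apply: (lt_trans un); have := m_sup n.
    have : n.+1%:R^-1 <= k.+1%:R^-1 :> R by rewrite lef_pV2 ?posrE// ler_nat.
    move: mk ik; move: (m n) (m k) (sup _) (n.+1%:R^-1) (k.+1%:R^-1).
    by move=> *; lra.
  exists ([set n | (k <= n)%N], [set n | (k <= n)%N]) => /=.
    by split; exists k.
  move=> [i j] /= [/close[Ki ui] /close[Kj uj]].
  rewrite -ball_normE /=.
  rewrite -(@ltr_pXn2r _ 2)// ?nnegrE ?(ltW e0)//.
  rewrite parallelogram; have := mle _ _ (Kmid _ _ _ Ki Kj).
  by rewrite re => ?; lra.
have /cauchy_cvgP/cvg_ex[l ul] := ucauchy.
by exists u, l; split => // n; have [] := uP n.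
Qed.

Lemma cvg_inner (I : Type) (F : set_system I) {FF : Filter F} (f : I -> H) l v :
  f @ F --> l -> (fun i => inner (f i) v) @ F --> inner l v.
Proof.
move=> /cvgrPdist_lt fl; apply/cvgrPdist_lt => e e0.
have d0 : 0 < `|v| + 1 by rewrite ltr_wpDl.
have := fl (e / (`|v| + 1)); rewrite divr_gt0// => /(_ isT).
apply: filterS => i; rewrite ltr_pdivlMr// -innerNl -innerDl; apply: le_lt_trans.
by apply: (le_trans (inner_abs_le _ _)); rewrite ler_wpM2l// lerDl.
Qed.

(** K is not assumed closed, so the projection l of x is only a limit of points
    of K.  Points of x - K of almost minimal norm form nested sets, and their
    limit x - l has minimal norm in the closure of x - K, hence is orthogonal
    to K. *)
Lemma orthogonal_projection (K : set H) x :
  K 0 -> (forall v w, K v -> K w -> K (v + w)) ->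
  (forall a v, K v -> K (a *: v)) ->
  exists (u : nat -> H) (l : H), [/\ forall n, K (u n), u @ \oo --> l &
    forall k, K k -> inner (x - l) k = 0].
Proof.
move=> K0 KD KZ.
pose N : set R := [set `|y| ^+ 2 | y in [set y | K (x - y)]].
have Ninf : has_inf N.
  split; first by exists (`|x| ^+ 2), x => //=; rewrite subrr.
  by exists 0 => _ [y _ <-]; exact: sqr_ge0.
pose m := inf N.
have mle y : K (x - y) -> m <= `|y| ^+ 2.
  by move=> Ky; apply: ge_inf; [have [] := Ninf|exists y].
have m0 : 0 <= m by apply: lb_le_inf => [|_ [y _ <-]]; [have [] := Ninf|exact: sqr_ge0].
pose L n := [set y | K (x - y) /\ `|y| ^+ 2 <= m + n.+1%:R^-1].
have [||||y [l [Ly yl]]] := @nested_midconvex_cvg L (m + 1).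
- move=> n; have e0 : 0 < n.+1%:R^-1 :> R by rewrite invr_gt0.
  by have [_ [y Ky <-] /ltW ym] := inf_adherent e0 Ninf; exists y.
- move=> n k nk y [Ky ym]; split => //; apply: (le_trans ym).
  by rewrite lerD2l lef_pV2 ?posrE// ler_nat ltnS.
- move=> n y z [Ky ym] [Kz zm]; split.
    have -> : x - 2^-1 *: (y + z) = 2^-1 *: ((x - y) + (x - z)).
      have {1}-> : x = 2^-1 *: (x + x).
        by rewrite -mulr2n -[x *+ 2]scaler_nat scalerA mulVf ?scale1r ?pnatr_eq0.
      by rewrite -scalerBr addrACA opprD.
    by apply/KZ/KD.
  have := sqr_ge0 `|y - z|; rewrite parallelogram.
  by move: ym zm; move: (_ ^-1) => p; move: (`|y| ^+ 2) (`|z| ^+ 2) => a b *; lra.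
- move=> n y [Ky ym]; have ym1 : `|y| ^+ 2 <= m + 1.
    by apply: (le_trans ym); rewrite lerD2l invf_le1 ?ltr0n// ler1n.
  have [y1|/ltW y1] := leP `|y| 1; first by rewrite (le_trans y1)// lerDr.
  by apply: le_trans ym1; rewrite expr2 ler_peMr.
exists (fun n => x - y n), (x - l); split.
- by move=> n; have [] := Ly n.
- by apply: cvgB => //; exact: cvg_cst.
move=> k Kk; rewrite opprB addrCA subrr addr0.
have sq_cvg (f : nat -> H) p :
    f @ \oo --> p -> (fun n => `|f n| ^+ 2) @ \oo --> `|p| ^+ 2.
  by move=> fp; rewrite expr2; apply: cvgM; exact: cvg_norm.
have lm : `|l| ^+ 2 <= m.
  have mm : (fun n => m + n.+1%:R^-1) @ \oo --> m.
    by rewrite -[X in _ --> X]addr0; apply: cvgD; [exact: cvg_cst|exact: cvg_harmonic].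
  apply: (ler_cvg_to (sq_cvg _ _ yl) mm).
  by apply: nearW => n; have [] := Ly n.
have ml a : m <= `|l + a *: k| ^+ 2.
  have yk : (fun n => y n + a *: k) @ \oo --> l + a *: k.
    by apply: cvgD => //; exact: cvg_cst.
  apply: (cvgr_to_ge (sq_cvg _ _ yk)).
  apply: nearW => n; apply: mle; rewrite opprD addrA -scaleNr.
  by apply: KD; [have [] := Ly n|exact: KZ].
set p := inner l k; set q := `|k| ^+ 2.
have q0 : 0 <= q by exact: sqr_ge0.
(* The minimiser of l + a k is at a = - p / q; dividing by q + 1 instead also
   covers k = 0 and still makes the norm decrease unless p = 0. *)
have := le_trans lm (ml (- p / (q + 1))).
rewrite norm_sqrD innerZr normrZ exprMn real_normK ?num_real// -/p -/q.
rewrite -subr_ge0.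
have -> : `|l| ^+ 2 + 2 * (- p / (q + 1) * p) + (- p / (q + 1)) ^+ 2 * q -
  `|l| ^+ 2 = - (p ^+ 2 * ((q + 2) / (q + 1) ^+ 2)).
  by field; rewrite gt_eqF// ltr_wpDl.
rewrite oppr_ge0 pmulr_lle0 ?divr_gt0 ?exprn_gt0 ?ltr_wpDl//.
by move=> p0; apply/eqP; rewrite -sqrf_eq0 eq_le p0 sqr_ge0.
Qed.

Lemma orthogonal_dense (K : set H) :
  K 0 -> (forall v w, K v -> K w -> K (v + w)) ->
  (forall a v, K v -> K (a *: v)) ->
  (forall x, (forall k, K k -> inner x k = 0) -> x = 0) -> dense K.
Proof.
move=> K0 KD KZ Korth O [x Ox] oO.
have [u [l [Ku ul xl]]] := @orthogonal_projection K x K0 KD KZ.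
have lx : l = x by apply/esym/subr0_eq/Korth.
have : nbhs l O by rewrite lx; exact: open_nbhs_nbhs.
by move=> /ul [n _ /(_ n (leqnn n)) Oun]; exists (u n).
Qed.

(** The representing vector is orthogonal to the kernel: project a point where f
    does not vanish on ker f, and rescale the difference. *)
Lemma riesz_representation (f : H -> R) (M : R) :
  scalar f -> (forall x, `|f x| <= M * `|x|) -> exists z, forall x, f x = inner z x.
Proof.
move=> flin fM.
have f0 : f 0 = 0.
  by apply/normr0_eq0/le_anti; rewrite normr_ge0 (le_trans (fM 0))// normr0 mulr0.
have fD x y : f (x + y) = f x + f y by have := flin 1 x y; rewrite scale1r mul1r.
have fZ a x : f (a *: x) = a * f x by have := flin a x 0; rewrite !addr0 f0 addr0.
have [[x fx]|/forallNP fx0] := pselect (exists x, f x <> 0); last first.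
  by exists 0 => x; rewrite inner0l; apply: contrapT; exact: fx0.
have [|v w /= fv fw|a v /= fv|u [l [Ku ul xl]]] :=
    @orthogonal_projection [set k | f k = 0] x.
- exact: f0.
- by rewrite fD fv fw addr0.
- by rewrite fZ fv mulr0.
have fl : f l = 0.
  apply/normr0_eq0/le_anti; rewrite normr_ge0 andbT.
  have M0 : (fun n => M * `|l - u n|) @ \oo --> M * `|l - l|.
    apply: cvgMr; apply: cvg_norm; apply: cvgB => //; exact: cvg_cst.
  rewrite subrr normr0 mulr0 in M0.
  apply: (cvgr_to_ge M0); apply: nearW => n.
  by apply: le_trans (fM _); rewrite fD -scaleN1r fZ Ku mulr0 addr0.
set y := x - l; have fy : f y = f x by rewrite fD -scaleN1r fZ fl mulr0 addr0.
have y0 : `|y| ^+ 2 != 0.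
  by rewrite sqrf_eq0 normr_eq0; apply/eqP => y0; apply: fx; rewrite -fy y0 f0.
exists ((f x / `|y| ^+ 2) *: y) => v.
have := xl (v - (f v / f x) *: y).
rewrite /= fD -scaleNr fZ fy mulNr divfK ?subrr; last exact/eqP.
move=> /(_ erefl); rewrite scaleNr innerDr innerNr innerZr inner_norm innerZl => /subr0_eq.
move: fx => /eqP fx; rewrite -/y => ->; field.
by rewrite fx -sqrf_eq0.
Qed.

Lemma bounded_adjoint (B : H -> H) (M : R) :
  linear B -> (forall x, `|B x| <= M * `|x|) ->
  exists A : H -> H, forall x y, inner (A x) y = inner x (B y).
Proof.
move=> Blin BM.
suff /choice[A AP] : forall x, exists z, forall y, inner z y = inner x (B y) by exists A.
move=> x; have [|y|z zP] := @riesz_representation (fun y => inner x (B y)) (`|x| * M).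
- by move=> a u v; rewrite Blin innerDr innerZr.
- by apply: (le_trans (inner_abs_le _ _)); rewrite -mulrA ler_wpM2l.
by exists z => y.
Qed.

Lemma adjoint_linear (A B : H -> H) :
  (forall x y, inner (A x) y = inner x (B y)) -> linear A.
Proof.
by move=> AB a x y; apply: inner_eql => v; rewrite AB !(innerDl, innerZl) !AB.
Qed.

Lemma adjoint_norm_le (A B : H -> H) c :
  (forall x y, inner (A x) y = inner x (B y)) ->
  (forall x, `|B x| <= c * `|x|) -> forall x, `|A x| <= c * `|x|.
Proof.
move=> AB Bc x; have [->|Ax0] := eqVneq (A x) 0.
  by rewrite normr0; exact: le_trans (Bc x).
rewrite -(@ler_pM2l _ `|A x|) ?normr_gt0// -expr2 -inner_norm AB.
rewrite (le_trans (ler_norm _))// (le_trans (inner_abs_le _ _))//.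
by rewrite mulrC mulrCA [leRHS]mulrA [c * _]mulrC ler_wpM2r// mulrC.
Qed.

End HilbertGeometry.

(** A nonzero z would be within distance |z| of some v in D, but z is orthogonal
    to v, so that |z - v| >= |z|. *)
Lemma dense_inner_eq0 (R : realType) (H : hilbertType R) (D : set H) z :
  dense D -> (forall v, D v -> inner z v = 0) -> z = 0.
Proof.
move=> Dd zD; apply/eqP/contraT => z0.
have nz : 0 < `|z| by rewrite normr_gt0.
have [|v [/= zv Dv]] := Dd (ball z `|z|) _ (ball_open z `|z|).
  by exists z; exact: ballxx.
have := inner_abs_le z (z - v).
rewrite innerDr innerNr (zD _ Dv) oppr0 addr0 inner_norm ger0_norm ?sqr_ge0//.
move: zv; rewrite -ball_normE /= => zv.
by rewrite expr2 leNgt ltr_pM2l// zv.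
Qed.

Section NormHalfSums.
Context {R : realType} {V : normedModType R}.

Lemma norm_le_half_sums (y z : V) (r : R) :
  `|y - z| <= r -> `|y + z| <= r -> `|y| <= r /\ `|z| <= r.
Proof.
move=> yBz yDz; split.
  have : 2 * `|y| <= `|y - z| + `|y + z|.
    have -> : 2 * `|y| = `|(y - z) + (y + z)|.
      by rewrite addrACA addNr addr0 -mulr2n normrMn mulr_natl.
    exact: ler_normD.
  by move: yBz yDz; lra.
have : 2 * `|z| <= `|y + z| + `|y - z|.
  have -> : 2 * `|z| = `|(y + z) - (y - z)|.
    by rewrite opprB addrC subrKA -mulr2n normrMn mulr_natl.
  exact: ler_normB.
by move: yBz yDz; lra.
Qed.

End NormHalfSums.

(** * Unbounded operators on a Hilbert space *)

Section OperatorNorm.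
Context {R : realType} {V : normedModType R}.
Implicit Types (T : operator V) (c : R).

Lemma norm_le_of_opnorm T c v : (opnorm T <= c%:E)%E ->
  (forall a u, dom T u -> dom T (a *: u) /\ T (a *: u) = a *: T u) ->
  dom T v -> `|T v| <= c * `|v|.
Proof.
move=> Tc TZ Dv; have [v0|v0] := eqVneq v 0.
  have [_] := TZ 0 v Dv; rewrite v0 !scale0r => ->.
  by rewrite !normr0 mulr0.
have nv : 0 < `|v| by rewrite normr_gt0.
have [Du Tu] := TZ (`|v|^-1) v Dv.
have : (`|T (`|v|^-1 *: v)|%:E <= c%:E)%E.
  apply: le_trans Tc; apply: ereal_sup_ubound.
  exists (`|v|^-1 *: v) => //; split => //=.
  by rewrite normrZ normfV normr_id mulVf// gt_eqF.
by rewrite lee_fin Tu normrZ normfV normr_id mulrC ler_pdivrMr.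
Qed.

Lemma opnorm_le T c : 0 <= c ->
  (forall v, dom T v -> `|T v| <= c * `|v|) -> (opnorm T <= c%:E)%E.
Proof.
move=> c0 Tc; apply: ub_ereal_sup => _ [v [Dv v1] <-].
rewrite lee_fin (le_trans (Tc _ Dv))//.
by rewrite -[leRHS]mulr1 ler_wpM2l.
Qed.

Lemma opnorm_lty_ex T : (opnorm T < +oo)%E -> exists c, (opnorm T <= c%:E)%E.
Proof.
case: (opnorm T) => [c _|//|_]; first by exists c.
by exists 0; rewrite leNye.
Qed.

End OperatorNorm.

Section DensityCriterion.
Context {R : realType} {H : hilbertType R}.

(** Suppose that x is orthogonal to dom(T) and x = T w_n + u_n with w_n small and
    u_n bounded in dom(T).  If u_n converges to l then, the graph being closed,
    T 0 = x - l, so that x = l is orthogonal to itself.  Convergence is arranged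
    by replacing the u_n by elements of the midpoint-convex sets K n of all
    remainders u which are orthogonal to x, bounded, and whose w is small. *)
Lemma dense_dom_of_vanishing_preimages (T : operator H) (C : R) :
  dom T 0 ->
  (forall v w, dom T v -> dom T w -> dom T (v + w) /\ T (v + w) = T v + T w) ->
  (forall a v, dom T v -> dom T (a *: v) /\ T (a *: v) = a *: T v) ->
  closed [set p : H * H | dom T p.1 /\ T p.1 = p.2] ->
  (forall n x, exists w u, [/\ dom T w, dom T u, T w = x - u,
     n.+1%:R * `|w| <= C * `|x| & `|u| <= C * `|x|]) ->
  dense (dom T).
Proof.
move=> dom0 TD TZ Tclosed split_ex.
apply: orthogonal_dense => //.
- by move=> v w /TD h /h[].
- by move=> a v /(TZ a)[].
move=> x xorth.
pose K n := [set u | [/\ inner x u = 0, `|u| <= C * `|x| &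
  exists w, [/\ dom T w, T w = x - u & n.+1%:R * `|w| <= C * `|x|]]].
have [||||u [l [Ku ul]]] := @nested_midconvex_cvg _ _ K (C * `|x|).
- move=> n; have [w [u [Dw Du Tw wn un]]] := split_ex n x.
  by exists u; split; [exact: xorth|by []|exists w].
- move=> n m nm u [xu un [w [Dw Tw wm]]]; split => //; exists w; split => //.
  by apply: le_trans wm; rewrite ler_wpM2r// ler_nat ltnS.
- move=> n u v [xu un [w [Dw Tw wn]]] [xv vn [z [Dz Tz zn]]].
  have [Dwz Twz] := TD _ _ Dw Dz; have [Dh Th] := TZ 2^-1 _ Dwz.
  have half_norm (y y' : H) :
      `|2^-1 *: (y + y')| <= 2^-1 * (`|y| + `|y'|).
    by rewrite normrZ ger0_norm ?invr_ge0// ler_wpM2l ?invr_ge0// ler_normD.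
  split.
  + by rewrite innerZr innerDr xu xv addr0 mulr0.
  + by apply: le_trans (half_norm _ _) _; lra.
  exists (2^-1 *: (w + z)); split => //.
    rewrite Th Twz Tw Tz addrACA -opprD scalerBr; congr (_ - _).
    by rewrite -mulr2n -[x *+ 2]scaler_nat scalerA mulVf ?scale1r ?pnatr_eq0.
  apply: (@le_trans _ _ (n.+1%:R * (2^-1 * (`|w| + `|z|)))).
    by rewrite ler_wpM2l.
  by move: wn zn; move: (n.+1%:R) => k; nra.
- by move=> n u [].
have /choice[w wP] : forall n, exists w,
    [/\ dom T w, T w = x - u n & n.+1%:R * `|w| <= C * `|x|].
  by move=> n; have [] := Ku n.
have w0 : w @ \oo --> (0 : H).
  apply/norm_cvg0P; apply: (@squeeze_cvgr _ _ _ _ (fun=> 0)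
    (fun n => C * `|x| * n.+1%:R^-1)).
  - by apply: nearW => n /=; rewrite normr_ge0/= ler_pdivlMr// mulrC; have [] := wP n.
  - exact: cvg_cst.
  - rewrite -[X in _ --> X](mulr0 (C * `|x|)); apply: cvgMr; exact: cvg_harmonic.
have [_ /= Tx] : [set p : H * H | dom T p.1 /\ T p.1 = p.2] (0, x - l).
  apply: (closed_cvg _ Tclosed (u_ := fun n => (w n, x - u n)) (F := \oo)).
    by apply: nearW => n /=; have [] := wP n.
  apply: cvg_pair => //; apply: cvgB => //; exact: cvg_cst.
have [_] := TZ 0 _ dom0; rewrite !scale0r Tx => /subr0_eq xl.
have xu0 : (fun n => inner (u n) x) @ \oo --> inner l x by exact: cvg_inner.
apply: inner_self_eq0; rewrite {1}xl.
apply: (cvg_unique _ xu0); first exact: norm_hausdorff.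
have -> : (fun n => inner (u n) x) = cst 0; last exact: cvg_cst.
by apply/funext => n; rewrite innerC; have [] := Ku n.
Qed.

End DensityCriterion.

(** * The Hilbert module as a Hilbert space *)

Section HilbertModuleIsHilbert.
Context {R : realType} {d : nat}.

Lemma hmodule_norm_sqr (VR : normedModType R) (v : hmodule d VR) :
  `|v| ^+ 2 = \sum_A `|v A| ^+ 2.
Proof. by rewrite [LHS]sqr_sqrtr// sumr_ge0// => A _; exact: sqr_ge0. Qed.

Lemma hmodule_coord_le (VR : normedModType R) (v : hmodule d VR) A :
  `|v A| <= `|v|.
Proof.
rewrite -(@ler_pXn2r _ 2)// ?nnegrE// hmodule_norm_sqr (bigD1 A)//= lerDl.
by apply: sumr_ge0 => B _; exact: sqr_ge0.
Qed.

Lemma hmodule_norm_le (VR : normedModType R) (v : hmodule d VR) :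
  `|v| <= \sum_A `|v A|.
Proof.
rewrite -(@ler_pXn2r _ 2)// ?nnegrE ?sumr_ge0// hmodule_norm_sqr [leRHS]expr2.
rewrite mulr_suml; apply: ler_sum => A _; rewrite expr2 ler_wpM2l//.
by rewrite (bigD1 A)//= lerDl sumr_ge0.
Qed.

(** The norm of V is equivalent to the sum of the norms of the finitely many
    components, and these are Cauchy in VR. *)
Lemma hmodule_complete (VR : completeNormedModType R)
    (F : set_system (hmodule d VR)) :
  ProperFilter F -> cauchy F -> cvg F.
Proof.
move=> FF /cauchy_ballP Fc.
have /choice[l Fl] : forall A, exists l : VR, (fun v : hmodule d VR => v A) @ F --> l.
  move=> A; apply/(cvg_ex ((fun v : hmodule d VR => v A) @ F)).
  apply: cauchy_cvg; apply/cauchy_ballP => e e0; near_simpl.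
  have [[P Q] /= [FP FQ] PQ] := Fc e e0.
  exists (P, Q) => // -[v w] /PQ /=; rewrite -!ball_normE /=.
  apply: le_lt_trans.
  by have := @hmodule_coord_le VR (v - w) A; rewrite !ffunE.
apply/cvg_ex; exists [ffun A => l A]; apply/cvgrPdist_lt => e e0.
have N0 : 0 < #|{set 'I_d}|%:R :> R by rewrite ltr0n; apply/card_gt0P; exists finset.set0.
have : F [set v : hmodule d VR |
    forall A, `|l A - v A| < e / #|{set 'I_d}|%:R].
  apply: filter_forall => A; have /cvgrPdist_lt := Fl A; apply.
  by rewrite divr_gt0.
apply: filterS => v lv; apply: (le_lt_trans (@hmodule_norm_le VR _)).
under eq_bigr do rewrite !ffunE.
apply: (@lt_le_trans _ _ (\sum_(A : {set 'I_d}) e / #|{set 'I_d}|%:R)).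
  apply: ltr_sum => //; apply/hasP.
  by exists finset.set0; rewrite ?mem_index_enum.
by rewrite sumr_const -[_ *+ _]mulr_natr divfK// gt_eqF.
Qed.

HB.instance Definition _ (VR : completeNormedModType R) :=
  Uniform_isComplete.Build (hmodule d VR) (@hmodule_complete VR).

Definition hinner (VR : hilbertType R) (v w : hmodule d VR) : R :=
  \sum_A inner (v A) (w A).

Context {VR : hilbertType R}.
Local Notation V := (hmodule d VR).
Implicit Types v w : V.

Lemma hinnerC v w : hinner v w = hinner w v.
Proof. by apply: eq_bigr => A _; rewrite innerC. Qed.

Lemma hinner_linear v : scalar (hinner v).
Proof.
move=> a w u; rewrite /hinner mulr_sumr -big_split; apply: eq_bigr => A _.
by rewrite !ffunE innerDr innerZr.
Qed.

Lemma hinner_linearl v : scalar (fun w => hinner w v).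
Proof. by move=> a w u; rewrite !(hinnerC _ v) hinner_linear. Qed.

HB.instance Definition _ := bilinear_isBilinear.Build R V V R *%R (idfun \; *%R)
  (@hinner VR) (hinner_linearl, hinner_linear).

Lemma hinner_herm v w : hinner v w = (-1) ^+ false * idfun (hinner w v).
Proof. by rewrite expr0 mul1r hinnerC. Qed.

HB.instance Definition _ :=
  isHermitianSesquilinear.Build R V false idfun (@hinner VR) hinner_herm.

Lemma hinner_norm v : hinner v v = `|v| ^+ 2.
Proof.
by rewrite hmodule_norm_sqr; apply: eq_bigr => A _; rewrite inner_norm.
Qed.

Lemma hinner_pos v : v != 0 -> 0 < hinner v v.
Proof. by move=> v0; rewrite hinner_norm exprn_gt0// normr_gt0. Qed.

HB.instance Definition _ := isDotProduct.Build R V (@hinner VR) hinner_pos.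

HB.instance Definition _ := NormedModule_isHilbert.Build R V hinner_norm.

End HilbertModuleIsHilbert.

(** * The Clifford algebra and its two actions *)

Section CliffordForm.
Context {R : realType} {d : nat}.
Local Notation cl := (clifford R d).
Local Notation e := (cbasis R).
Implicit Types (A B C : {set 'I_d}) (s t u : cl).

Lemma cbasisM A B :
  e A * e B = (-1) ^+ swaps A B *: e (symdiff A B).
Proof. exact: cmul_basis. Qed.

Lemma symdiffC A B : symdiff A B = symdiff B A.
Proof. by rewrite /symdiff finset.setUC. Qed.

Lemma symdiffK A B : symdiff A (symdiff A B) = B.
Proof.
rewrite symdiffA [symdiff A A]/symdiff finset.setDv finset.setU0.
by rewrite symdiff0l.
Qed.

Lemma symdiff_eq A B C : (symdiff A B == C) = (B == symdiff A C).
Proof.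
by apply/eqP/eqP => [<-|->]; rewrite symdiffK.
Qed.

(** Among the ordered pairs of A, those with j <= i and those with i <= j are
    equinumerous and share the diagonal.  This identifies the sign of the
    conjugation with the sign of e_A e_A. *)
Lemma swaps_self A : swaps A A = (#|A| * #|A|.+1)./2.
Proof.
suff H : (swaps A A).*2 = (#|A| * #|A|.+1)%N by rewrite -H doubleK.
have -> : (swaps A A).*2 =
    (\sum_(i in A) \sum_(j in A) ((j <= i)%N + (i <= j)%N))%N.
  under [RHS]eq_bigr do rewrite big_split.
  by rewrite big_split/= -addnn; congr (_ + _)%N; rewrite [RHS]exchange_big.
transitivity (\sum_(i in A) (#|A| + 1))%N; last first.
  by rewrite sum_nat_const addn1.
apply: eq_bigr => i iA.
transitivity (\sum_(j in A) (1 + (j == i)))%N.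
  by apply: eq_bigr => j _; rewrite -(inj_eq val_inj)/=; case: ltngtP.
rewrite big_split/= sum1_card; congr (_ + _)%N.
by rewrite (bigD1 i)//= eqxx big1// => j /andP[_ /negPf->].
Qed.

Lemma sign_sqr n : (-1) ^+ n * (-1) ^+ n = 1 :> R.
Proof. by rewrite -expr2 sqrr_sign. Qed.

Lemma cbasisE A B : e A B = (B == A)%:R :> R.
Proof. by rewrite ffunE. Qed.

Lemma cconj_basis A : cconj (e A) = (-1) ^+ swaps A A *: e A.
Proof.
rewrite /cconj (bigD1 A)//= [X in _ + X]big1 ?addr0.
  by rewrite cbasisE eqxx mulr1 swaps_self.
by move=> B /negPf BA; rewrite cbasisE BA mulr0 scale0r.
Qed.

Lemma cconj_linear : linear (@cconj R d).
Proof.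
move=> a s t; rewrite /cconj scaler_sumr -big_split; apply: eq_bigr => A _ /=.
by rewrite !ffunE mulrDr scalerDl scalerA; congr (_ *: _ + _); exact: mulrCA.
Qed.

HB.instance Definition _ :=
  GRing.isLinear.Build R cl cl *:%R (@cconj R d) cconj_linear.

Lemma cconjE s A : cconj s A = (-1) ^+ swaps A A * s A.
Proof.
rewrite /cconj sum_ffunE (bigD1 A)//= big1 ?addr0; last first.
  by move=> B /negPf BA; rewrite ffunE cbasisE eq_sym BA; exact: mulr0.
by rewrite ffunE cbasisE eqxx swaps_self; exact: mulr1.
Qed.

Lemma cconjK : involutive (@cconj R d).
Proof. by move=> s; apply/ffunP => A; rewrite !cconjE mulrA sign_sqr mul1r. Qed.

(** The scalar part of (cconj s) * t, in coordinates. *)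
Definition cdot s t : R := \sum_A s A * t A.

Lemma cdotC s t : cdot s t = cdot t s.
Proof. by apply: eq_bigr => A _; rewrite mulrC. Qed.

Lemma cdot_linear s : scalar (cdot s).
Proof.
move=> a t u; rewrite /cdot mulr_sumr -big_split; apply: eq_bigr => A _ /=.
by rewrite !ffunE mulrDr; congr (_ + _); exact: mulrCA.
Qed.

Lemma cdot_linearl s : scalar (fun t => cdot t s).
Proof. by move=> a t u; rewrite !(cdotC _ s) cdot_linear. Qed.

Lemma cdotZr a s t : cdot s (a *: t) = a * cdot s t.
Proof.
by rewrite /cdot mulr_sumr; apply: eq_bigr => A _; rewrite !ffunE; exact: mulrCA.
Qed.

Lemma cdotZl a s t : cdot (a *: s) t = a * cdot s t.
Proof. by rewrite cdotC cdotZr cdotC. Qed.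

Lemma cbasis_ind (P : cl -> Prop) :
  (forall A, P (e A)) -> (forall a s t, P s -> P t -> P (a *: s + t)) ->
  forall s, P s.
Proof.
move=> Pe PD s; rewrite (cbasis_sum s); apply: big_ind => [|t u Pt Pu|A _].
- have := PD (-1) _ _ (Pe finset.set0) (Pe finset.set0).
  by rewrite scaleN1r addNr.
- by rewrite -[t]scale1r; exact: PD.
- suff P0 : P 0 by rewrite -[_ *: _]addr0; exact: PD.
  have := PD (-1) _ _ (Pe finset.set0) (Pe finset.set0).
  by rewrite scaleN1r addNr.
Qed.

Lemma cdot_basis A B : cdot (e A) (e B) = (A == B)%:R.
Proof.
rewrite /cdot (bigD1 A)//= !cbasisE eqxx mul1r big1 ?addr0// => C /negPf CA.
by rewrite !cbasisE CA mul0r.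
Qed.

(** By linearity s, t, u may be taken in the basis, where both sides compare the
    same two index sets, and the signs agree because e_A is conjugated with the
    sign of e_A e_A. *)
Lemma cdot_mull s t u : cdot (s * t) u = cdot t (cconj s * u).
Proof.
elim/cbasis_ind: s => [A|a s s' IH IH']; last first.
  rewrite linearP !mulrDl -!scalerAl cdot_linearl IH IH'.
  by rewrite cdot_linear.
elim/cbasis_ind: t => [B|a t t' IH IH']; last first.
  by rewrite mulrDr -scalerAr !cdot_linearl IH IH'.
elim/cbasis_ind: u => [C|a u u' IH IH']; last first.
  by rewrite mulrDr -scalerAr !cdot_linear IH IH'.
rewrite cconj_basis -scalerAl !cbasisM scalerA.
rewrite cdotZl cdotZr.
rewrite !cdot_basis symdiff_eq; case: eqP => [->|_]; last by rewrite !mulr0.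
by rewrite !mulr1 swaps_symdiffr.
Qed.

Lemma cdot_mulr s t u : cdot (t * s) u = cdot t (u * cconj s).
Proof.
elim/cbasis_ind: s => [A|a s s' IH IH']; last first.
  rewrite linearP !mulrDr -!scalerAr cdot_linearl IH IH'.
  by rewrite cdot_linear.
elim/cbasis_ind: t => [B|a t t' IH IH']; last first.
  by rewrite mulrDl -scalerAl !cdot_linearl IH IH'.
elim/cbasis_ind: u => [C|a u u' IH IH']; last first.
  by rewrite mulrDl -scalerAl !cdot_linear IH IH'.
rewrite cconj_basis -scalerAr !cbasisM scalerA !cdotZl !cdotZr.
rewrite !cdot_basis [symdiff B A]symdiffC symdiff_eq [symdiff A C]symdiffC.
case: eqP => [->|_]; last by rewrite !mulr0.
by rewrite !mulr1 swaps_symdiffl mulrC.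
Qed.

End CliffordForm.

Section HilbertModuleActions.
Context {R : realType} {d : nat} {VR : hilbertType R}.
Local Notation cl := (clifford R d).
Local Notation V := (hmodule d VR).
Local Notation e := (cbasis R).
Implicit Types (A B C : {set 'I_d}) (s t a : cl) (v w : V) (x y : VR).

Lemma tensor_linearl s : linear (fun x : VR => tensor x s).
Proof.
move=> c x y; apply/ffunP => A; rewrite !ffunE scalerDr !scalerA.
by rewrite [s A * c]mulrC.
Qed.

Lemma tensor_linearr x : linear (@tensor R d VR x).
Proof. by move=> c s t; apply/ffunP => A; rewrite !ffunE scalerDl scalerA. Qed.

HB.instance Definition _ x := GRing.isLinear.Build R cl V *:%R (@tensor R d VR x)
  (tensor_linearr x).

Lemma tensorZl c x s : tensor (c *: x) s = c *: tensor x s.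
Proof. by apply/ffunP => A; rewrite !ffunE !scalerA mulrC. Qed.

(** With this decomposition each identity about the two actions reduces to one in
    the Clifford algebra. *)
Lemma tensor_sum v : v = \sum_A tensor (v A) (e A).
Proof.
apply/ffunP => B; rewrite sum_ffunE (bigD1 B)//= big1 ?addr0.
  by rewrite !ffunE eqxx scale1r.
by move=> A /negPf AB; rewrite !ffunE eq_sym AB scale0r.
Qed.

Lemma lmulcE s v : lmulc s v = \sum_A tensor (v A) (s * e A).
Proof.
apply: eq_bigr => A _; rewrite [in RHS](cbasis_sum s) mulr_suml linear_sum.
by apply: eq_bigr => B _; rewrite tensorZl -scalerAl linearZ.
Qed.

Lemma rmulcE v s : rmulc v s = \sum_A tensor (v A) (e A * s).
Proof.
apply: eq_bigr => A _; rewrite [in RHS](cbasis_sum s) mulr_sumr linear_sum.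
by apply: eq_bigr => B _; rewrite tensorZl -scalerAr linearZ.
Qed.

Lemma lmulc_linear s : linear (lmulc s : V -> V).
Proof.
move=> c v w; rewrite !lmulcE scaler_sumr -big_split; apply: eq_bigr => A _ /=.
by rewrite !ffunE tensor_linearl.
Qed.

HB.instance Definition _ s := GRing.isLinear.Build R V V *:%R (@lmulc R d VR s)
  (lmulc_linear s).

Lemma lmulc_linearl v : linear (fun s => lmulc s v).
Proof.
move=> c s t; rewrite !lmulcE scaler_sumr -big_split; apply: eq_bigr => A _ /=.
by rewrite mulrDl -scalerAl linearP.
Qed.

Lemma lmulcB (a b : clifford R d) (v : V) :
  lmulc (a - b) v = lmulc a v - lmulc b v.
Proof. exact: (GRing.zmod_morphism_linear (lmulc_linearl v)). Qed.

Lemma lmulcN (a : clifford R d) (v : V) : lmulc (- a) v = - lmulc a v.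
Proof.
by have /= := GRing.scalable_linear (lmulc_linearl v) (-1) a; rewrite !scaleN1r.
Qed.

Lemma lmulc_tensor s x t : lmulc s (tensor x t) = tensor x (s * t).
Proof.
rewrite lmulcE [in RHS](cbasis_sum t) mulr_sumr linear_sum.
by apply: eq_bigr => A _; rewrite ffunE tensorZl -scalerAr linearZ.
Qed.

Lemma lmulcA s t v : lmulc s (lmulc t v) = lmulc (s * t) v.
Proof.
rewrite [lmulc t v]lmulcE linear_sum [RHS]lmulcE /=.
by apply: eq_bigr => A _; rewrite lmulc_tensor mulrA.
Qed.

Lemma lmulc_scalar c v : lmulc (c *: 1) v = c *: v.
Proof.
rewrite lmulcE [in RHS](tensor_sum v) scaler_sumr.
by apply: eq_bigr => A _; rewrite -scalerAl mul1r linearZ.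
Qed.

Lemma rmulc_scalar c v : rmulc v (c *: 1) = c *: v.
Proof.
rewrite rmulcE [in RHS](tensor_sum v) scaler_sumr.
by apply: eq_bigr => A _; rewrite -scalerAr mulr1 linearZ.
Qed.

Lemma inner_tensor x y s t : inner (tensor x s) (tensor y t) = inner x y * cdot s t.
Proof.
rewrite mulr_sumr; apply: eq_bigr => A _.
by rewrite !ffunE innerZl innerZr; ring.
Qed.

Lemma inner_suml I (r : seq I) (F : I -> V) w :
  inner (\sum_(i <- r) F i) w = \sum_(i <- r) inner (F i) w.
Proof.
exact: (big_morph (fun v => inner v w) (fun u v => innerDl u v w) (inner0l w)).
Qed.

Lemma inner_sumr I (r : seq I) (F : I -> V) w :
  inner w (\sum_(i <- r) F i) = \sum_(i <- r) inner w (F i).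
Proof. by rewrite innerC inner_suml; apply: eq_bigr => i _; rewrite innerC. Qed.

Lemma inner_lmulc s v w : inner (lmulc s v) w = inner v (lmulc (cconj s) w).
Proof.
rewrite lmulcE [w in LHS]tensor_sum [v in RHS]tensor_sum lmulcE !inner_suml.
apply: eq_bigr => A _; rewrite !inner_sumr; apply: eq_bigr => B _.
by rewrite !inner_tensor cdot_mull.
Qed.

Lemma inner_rmulc s v w : inner (rmulc v s) w = inner v (rmulc w (cconj s)).
Proof.
rewrite rmulcE [w in LHS]tensor_sum [v in RHS]tensor_sum rmulcE !inner_suml.
apply: eq_bigr => A _; rewrite !inner_sumr; apply: eq_bigr => B _.
by rewrite !inner_tensor cdot_mulr.
Qed.

Lemma cdot_basisr s A : cdot s (e A) = s A.
Proof.
rewrite /cdot (bigD1 A)//= cbasisE eqxx mulr1 big1 ?addr0// => C /negPf CA.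
by rewrite cbasisE CA mulr0.
Qed.

(** The coefficient of e_A in a Clifford number c is the scalar part of c times
    the conjugate of e_A.  Hence the real inner product determines the
    Clifford-valued one. *)
Lemma cinner_coord v w A : cinner v w A = inner v (rmulc w (cconj (e A))).
Proof.
rewrite {1}/cinner [v in RHS]tensor_sum rmulcE inner_suml sum_ffunE.
apply: eq_bigr => B _; rewrite inner_sumr sum_ffunE; apply: eq_bigr => C _.
rewrite inner_tensor ffunE; congr (_ * _).
by rewrite -cdot_mulr [RHS]cdotC -[in RHS](cconjK (e B)) -cdot_mull cdot_basisr.
Qed.

End HilbertModuleActions.

(** * Paravectors *)

Section Paravectors.
Context {R : realType} {d : nat}.
Local Notation cl := (clifford R d).
Implicit Types (s t : paravector R d).

Definition paravec s : cl := \sum_(i < d) s 0 (lift ord0 i) *: cgen R i.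

Definition paravec_abs s : R := Num.sqrt (\sum_(i < d) s 0 (lift ord0 i) ^+ 2).

Lemma paraE s : para s = s 0 ord0 *: 1 + paravec s.
Proof. by []. Qed.

Lemma set1_neq0 (i : 'I_d) : (finset.set0 == [set i]%SET) = false.
Proof. by apply/eqP => /setP/(_ i); rewrite !inE eqxx. Qed.

Lemma paravec_coord0 s : paravec s finset.set0 = 0.
Proof.
rewrite sum_ffunE big1// => i _; rewrite ffunE cbasisE set1_neq0.
exact: mulr0.
Qed.

Lemma paravec_coord1 s i : paravec s [set i]%SET = s 0 (lift ord0 i).
Proof.
rewrite sum_ffunE (bigD1 i)//= big1 ?addr0.
  by rewrite ffunE cbasisE eqxx; exact: mulr1.
move=> j /negPf ji; rewrite ffunE cbasisE (inj_eq finset.set1_inj) eq_sym ji.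
exact: mulr0.
Qed.

Lemma cdot_suml I (r : seq I) (F : I -> cl) u :
  cdot (\sum_(i <- r) F i) u = \sum_(i <- r) cdot (F i) u.
Proof.
rewrite /cdot exchange_big/=; apply: eq_bigr => A _.
by rewrite sum_ffunE mulr_suml.
Qed.

(** The e_i with the unit 1 are orthonormal for the coordinate form. *)
Lemma para_abs_sqr s :
  cabs (para s) ^+ 2 = s 0 ord0 ^+ 2 + paravec_abs s ^+ 2.
Proof.
rewrite /paravec_abs !sqr_sqrtr; try by apply: sumr_ge0 => *; exact: sqr_ge0.
transitivity (cdot (para s) (para s)).
  by apply: eq_bigr => A _; rewrite expr2.
rewrite {1}paraE -[_ *: 1 + _]/(_ *: cbasis R finset.set0 + paravec s).
rewrite cdot_linearl cdotC cdot_basisr /paravec cdot_suml expr2; congr (_ * _ + _).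
  by rewrite ffunE paravec_coord0 ffunE cbasisE eqxx addr0; exact: mulr1.
apply: eq_bigr => i _; rewrite cdotZl cdotC cdot_basisr expr2; congr (_ * _).
rewrite ffunE paravec_coord1 ffunE cbasisE eq_sym set1_neq0.
by rewrite [X in X + _]mulr0 add0r.
Qed.

Lemma para_abs_sum s : cabs (para s) = Num.sqrt (\sum_j s 0 j ^+ 2).
Proof.
rewrite big_ord_recl -[LHS]ger0_norm ?sqrtr_ge0// -sqrtr_sqr para_abs_sqr.
by rewrite sqr_sqrtr// sumr_ge0// => i _; exact: sqr_ge0.
Qed.

Lemma para_abs_eq0 s : (cabs (para s) == 0) = (s == 0).
Proof.
apply/idP/eqP => [|->]; last first.
  rewrite para_abs_sum big1 ?sqrtr0// => i _.
  by rewrite mxE expr0n.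
rewrite -sqrf_eq0 para_abs_sum sqr_sqrtr ?sumr_ge0//; last first.
  by move=> i _; exact: sqr_ge0.
rewrite psumr_eq0 => [/allP s0|i _]; last exact: sqr_ge0.
apply/rowP => i; rewrite mxE; apply/eqP.
by have := s0 i (mem_index_enum i); rewrite /= sqrf_eq0.
Qed.

(** The square of x is counted twice, once with the two factors exchanged: the
    terms with i <> j cancel by anticommutation. *)
Lemma paravec_sqr s : paravec s * paravec s = (- paravec_abs s ^+ 2) *: 1.
Proof.
rewrite sqr_sqrtr; last by apply: sumr_ge0 => *; exact: sqr_ge0.
pose c i := s 0 (lift ord0 i); set S := _ * _.
have SE : S = \sum_i \sum_j (c i * c j) *: (cgen R i * cgen R j).
  rewrite /S /paravec mulr_suml; apply: eq_bigr => i _.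
  rewrite mulr_sumr; apply: eq_bigr => j _.
  by rewrite -scalerAl -scalerAr scalerA.
have S2 : S + S = (- \sum_i c i ^+ 2) *: 1 + (- \sum_i c i ^+ 2) *: 1.
  rewrite {1}SE {1}SE [X in X + _]exchange_big/= -big_split/= -scalerDl -opprD -mulr2n.
  rewrite -sumrMnl -sumrN scaler_suml; apply: eq_bigr => i _.
  rewrite -big_split/= (bigD1 i)//= big1 ?addr0; last first.
    move=> j ji; rewrite (cgen_anticomm R ji) [c j * c i]mulrC scalerN.
    by rewrite addNr.
  by rewrite cgen_sqr -expr2 !scalerN -opprD -scalerDl scaleNr mulr2n.
apply: (@scalerI _ _ (2 : R)); first by rewrite pnatr_eq0.
by rewrite !scaler_nat !mulr2n.
Qed.

Lemma cconj_paravec s : cconj (paravec s) = - paravec s.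
Proof.
rewrite linear_sum -sumrN; apply: eq_bigr => i _.
rewrite linearZ/= cconj_basis /swaps big_set1 big_set1 leqnn expr1 scaleN1r.
by rewrite scalerN.
Qed.

Lemma cconj_para s : cconj (para s) = s 0 ord0 *: 1 - paravec s.
Proof.
rewrite linearD linearZ/= cconj_paravec.
by rewrite cconj_basis /swaps big_set0 expr0 scale1r.
Qed.

(** The conjugate of x is - x and x^2 = - |x|^2, so multiplication by x is |x|
    times an isometry. *)
Lemma norm_lmulc_paravec (VR : hilbertType R) s (v : hmodule d VR) :
  `|lmulc (paravec s) v| = paravec_abs s * `|v|.
Proof.
apply/eqP; rewrite -(@eqrXn2 _ 2)// ?mulr_ge0 ?sqrtr_ge0//; apply/eqP.
rewrite -inner_norm inner_lmulc cconj_paravec lmulcA mulNr paravec_sqr.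
by rewrite scaleNr opprK lmulc_scalar innerZr inner_norm exprMn.
Qed.

(** The paravector whose Clifford number is the conjugate of the one of s. *)
Definition para_conj s : paravector R d :=
  \row_j (if j == ord0 then s 0 j else - s 0 j).

Lemma para_conj_re s : para_conj s 0 ord0 = s 0 ord0.
Proof. by rewrite mxE eqxx. Qed.

Lemma paravec_conj s : paravec (para_conj s) = - paravec s.
Proof.
by rewrite -sumrN; apply: eq_bigr => i _; rewrite mxE /= scaleNr.
Qed.

Lemma para_conj_abs s : cabs (para (para_conj s)) = cabs (para s).
Proof.
rewrite !para_abs_sum; congr Num.sqrt; apply: eq_bigr => j _.
by rewrite mxE; case: ifP; rewrite // sqrrN.
Qed.

Lemma para_re_le s : `|s 0 ord0| <= cabs (para s).
Proof.
rewrite -(@ler_pXn2r _ 2)// ?nnegrE ?sqrtr_ge0// para_abs_sqr.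
by rewrite real_normK ?num_real// lerDl sqr_ge0.
Qed.

Lemma para_abs_continuous : continuous (fun s => cabs (para s)).
Proof.
have -> : (fun s => cabs (para s)) =
    Num.sqrt \o (fun s : paravector R d => \sum_j s 0 j ^+ 2).
  by apply/funext => s; rewrite para_abs_sum.
suff cont (r : seq 'I_d.+1) :
    continuous (fun s : paravector R d => \sum_(j <- r) s 0 j ^+ 2).
  by move=> s; apply: continuous_comp; [exact: cont|exact: sqrt_continuous].
elim: r => [|j r IH].
  have -> : (fun s : paravector R d => \sum_(j <- [::]) s 0 j ^+ 2) = cst 0.
    by apply/funext => s; rewrite big_nil.
  exact: cst_continuous.
have -> : (fun s : paravector R d => \sum_(i <- j :: r) s 0 i ^+ 2) =
    (fun s => s 0 j * s 0 j + \sum_(i <- r) s 0 i ^+ 2).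
  by apply/funext => s; rewrite big_cons expr2.
move=> s; have sj := @coord_continuous R 1 d.+1 0 j s.
exact: (cvgD (cvgM sj sj) (IH s)).
Qed.

End Paravectors.

(** * Double sectors *)

Section DoubleSector.
Context {R : realType} {d : nat}.
Implicit Types (s t : paravector R d) (phi omega : R).

(** As Arg s lies in [0, pi], where cos decreases, the two intervals of I_phi say
    that s_0 / |s| is greater than cos phi or less than - cos phi. *)
Lemma double_sectorE phi s : 0 < phi < pi / 2 ->
  double_sector phi s <-> s != 0 /\ cos phi * cabs (para s) < `|s 0 ord0|.
Proof.
move=> /andP[phi0 phi2].
have dom_phi : phi \in `[0, pi].
  rewrite in_itv/= (ltW phi0)/=; have := pi_gt0 R.
  by move: phi2; move: (pi : R) => p; lra.
have dom_pi_phi : pi - phi \in `[0, pi].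
  move: dom_phi; rewrite !in_itv/= => /andP[phi_ge0 phi_le].
  by rewrite subr_ge0 gerBl phi_ge0 phi_le.
have cos_pi_phi : cos (pi - phi) = - cos phi :> R.
  by rewrite addrC cosDpi cosN.
have [->|s0] := eqVneq s 0; first by split=> -[/eqP].
have c0 : 0 < cabs (para s) by rewrite lt_def para_abs_eq0 s0 sqrtr_ge0.
pose x := s 0 ord0 / cabs (para s).
have x1 : -1 <= x <= 1.
  by rewrite -ler_norml normrM normfV (ger0_norm (ltW c0)) ler_pdivrMr// mul1r para_re_le.
have acos_dom : acos x \in `[0, pi] by rewrite in_itv/= acos_ge0// acos_lepi.
have xE : (cos phi * cabs (para s) < `|s 0 ord0|) = (cos phi < x) || (x < - cos phi).
  rewrite -ltr_pdivlMr// -[X in _ / X](ger0_norm (ltW c0)) -normfV -normrM -/x.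
  by rewrite lter_normr ltrNr.
have lt_phi : (acos x < phi) = (cos phi < x).
  by rewrite -(ltr_cos acos_dom dom_phi) acosK.
have gt_phi : (pi - phi < acos x) = (x < - cos phi).
  by rewrite -cos_pi_phi -[in RHS](acosK (x := x))// ltr_cos.
rewrite xE -lt_phi -gt_phi; split=> -[_ sP]; split => //.
  by case: sP; rewrite /= in_itv/= /Arg -/x => /andP[? ?]; apply/orP; [left|right].
case/orP: sP => sP; [left|right]; rewrite /= in_itv/= /Arg -/x sP.
  by rewrite andbT (@lt_le_trans _ _ 0)// ?oppr_lt0// acos_ge0.
by rewrite (@le_lt_trans _ _ pi)// ?acos_lepi// ltrDl.
Qed.

Lemma cos_bounds phi : 0 < phi < pi / 2 -> 0 < cos phi < 1.
Proof.
move=> /andP[phi0 phi2]; have p0 := pi_gt0 R.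
rewrite cos_gt0_pihalf; last first.
  by apply/andP; split=> //; apply: lt_trans phi0; rewrite oppr_lt0 divr_gt0.
rewrite -[X in _ < X]cos0 ltr_cos// in_itv/= ?lexx ?(ltW phi0) ?(ltW p0)//=.
by move: phi2 p0; move: (pi : R) => p; lra.
Qed.

(** The right-hand side is a closed condition.  Conversely, moving s away from
    the imaginary hyperplane by any a > 0 makes the inequality strict, since
    cos omega < 1. *)
Lemma closure_double_sectorP omega s : 0 < omega < pi / 2 ->
  closure (double_sector omega) s <-> cos omega * cabs (para s) <= `|s 0 ord0|.
Proof.
move=> omegaP; have /andP[c0 c1] := cos_bounds omegaP; split.
  pose f t : R := `|t 0 ord0| - cos omega * cabs (para t).
  have fcont : continuous f.
    move=> t; have t0 := @coord_continuous R 1 d.+1 0 ord0 t.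
    exact: (cvgB (cvg_norm t0) (cvgM (cvg_cst _) (@para_abs_continuous R d t))).
  have fclosed : closed (f @^-1` [set x | 0 <= x]).
    by apply: preimage_closed; [move=> t _; exact: fcont|exact: closed_ge].
  rewrite -subr_ge0 => sP; apply: fclosed; apply: closureS sP => t.
  by move=> /(double_sectorE _ omegaP)[_ tP]; rewrite /f /= subr_ge0 ltW.
(* The sign of s_0, with value 1 at 0 so that s = 0 is moved as well. *)
move=> sP; pose sg : R := if 0 <= s 0 ord0 then 1 else -1.
pose t (a : R) : paravector R d := s + (a * sg) *: delta_mx 0 ord0.
have tcvg : t a @[a --> 0^'+] --> s.
  rewrite -[X in _ --> X]addr0 -[X in _ + X](scale0r (delta_mx 0 ord0)).
  apply: cvgD; first exact: cvg_cst.
  apply: cvgZr_tmp; rewrite -[X in _ --> X](mul0r sg).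
  by apply: cvgMl; apply: cvg_at_right_filter; exact: cvg_id.
have tE a : 0 < a -> double_sector omega (t a).
  move=> a0; have t0 : `|t a 0 ord0| = `|s 0 ord0| + a.
    rewrite !mxE !eqxx mulr1 /sg; case: (leP 0 (s 0 ord0)) => h.
      by rewrite mulr1 !ger0_norm ?addr_ge0// ltW.
    rewrite mulrN1 (ltr0_norm h) ltr0_norm ?subr_lt0 ?(lt_trans h)//.
    by rewrite opprB addrC.
  have tv : paravec_abs (t a) = paravec_abs s.
    rewrite /paravec_abs; congr Num.sqrt; apply: eq_bigr => i _.
    by rewrite !mxE mulr0 addr0.
  apply/double_sectorE => //; split.
    apply/eqP => ta0; have := t0; rewrite ta0 mxE normr0 => /esym/eqP.
    by rewrite paddr_eq0 ?(ltW a0)// (gt_eqF a0) andbF.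
  rewrite t0 -(@ltr_pXn2r _ 2)// ?nnegrE ?addr_ge0 ?mulr_ge0 ?sqrtr_ge0
    ?(ltW a0) ?(ltW c0)//.
  rewrite exprMn para_abs_sqr tv -[t a 0 ord0 ^+ 2]real_normK ?num_real// t0.
  move: sP; rewrite -(@ler_pXn2r _ 2)// ?nnegrE ?mulr_ge0 ?sqrtr_ge0 ?(ltW c0)//.
  rewrite exprMn para_abs_sqr -[s 0 ord0 ^+ 2]real_normK ?num_real//.
  have := normr_ge0 (s 0 ord0); move: `|s 0 ord0| (paravec_abs s ^+ 2) => x q x0.
  have cc : cos omega ^+ 2 < 1 by rewrite expr_lt1// ltW.
  move: (cos omega ^+ 2) cc => k k1 kx.
  have : 0 < (1 - k) * (2 * x * a + a ^+ 2).
    by rewrite mulr_gt0 ?subr_gt0// ltr_wpDl ?exprn_gt0// !mulr_ge0// ltW.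
  by move=> h; nra.
move=> O /tcvg /= tO; near (0 : R)^'+ => a.
by exists (t a); split; [exact: tE|near: a].
Unshelve. all: by end_near. Qed.

(** There is room between |s_0| / |s| and cos omega; phi is taken with cosine
    halfway between them, which also keeps cos phi > 0. *)
Lemma sector_escape omega s : 0 < omega < pi / 2 ->
  ~ closure (double_sector omega) s ->
  exists2 phi, omega < phi < pi / 2 & ~ (double_sector phi `|` [set 0]) s.
Proof.
move=> omegaP; rewrite closure_double_sectorP// => /negP; rewrite -ltNge => sP.
have /andP[c0 c1] := cos_bounds omegaP.
have s0 : 0 < cabs (para s).
  rewrite -(pmulr_rgt0 _ c0); apply: le_lt_trans sP; exact: normr_ge0.
pose x := `|s 0 ord0| / cabs (para s).
have xc : x < cos omega by rewrite ltr_pdivrMr.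
have x0 : 0 <= x by rewrite divr_ge0// ltW.
pose y := (x + cos omega) / 2.
have y0 : 0 < y by rewrite divr_gt0// ltr_wpDl.
have yc : y < cos omega by rewrite /y; lra.
have xy : x <= y by rewrite /y; lra.
have y1 : -1 <= y <= 1.
  by rewrite (le_trans _ (ltW y0)) ?lerN10//= ltW// (lt_trans yc).
have p0 := pi_gt0 R; have /andP[om0 om2] := omegaP.
have omega_dom : omega \in `[0, pi].
  by rewrite in_itv/= (ltW om0)/=; move: om2 p0; move: (pi : R) => p; lra.
have pi2_dom : (pi / 2 : R) \in `[0, pi].
  by rewrite in_itv/=; move: p0; move: (pi : R) => p ?; apply/andP; split; lra.
have acos_dom : acos y \in `[0, pi] by rewrite in_itv/= acos_ge0// acos_lepi.
have phiP : omega < acos y < pi / 2.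
  rewrite -(ltr_cos omega_dom acos_dom) -(ltr_cos acos_dom pi2_dom) !acosK//.
  by rewrite cos_pihalf yc y0.
exists (acos y) => // -[|/eqP]; last first.
  by rewrite -para_abs_eq0 gt_eqF.
have /andP[p1 p2] := phiP.
rewrite double_sectorE ?p2 ?(lt_trans om0)// acosK// => -[_].
by rewrite -ltr_pdivlMr// -/x ltNge xy.
Qed.

Lemma sector_disjoint omega phi s : 0 < omega < pi / 2 -> omega < phi < pi / 2 ->
  ~ (double_sector phi `|` [set 0]) s -> ~ closure (double_sector omega) s.
Proof.
move=> omegaP /andP[op p2] sP; rewrite closure_double_sectorP//.
have /andP[om0 om2] := omegaP.
have phiP : 0 < phi < pi / 2 by rewrite p2 (lt_trans om0).
have s0 : s != 0 by apply/eqP => s0; apply: sP; right.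
have c0 : 0 < cabs (para s) by rewrite lt_def para_abs_eq0 s0 sqrtr_ge0.
have p0 := pi_gt0 R.
have cc : cos phi < cos omega.
  rewrite ltr_cos// in_itv/=; move: om0 om2 op p2 p0; move: (pi : R) => p *;
  by apply/andP; split; lra.
move=> /(lt_le_trans _) h; apply: sP; left; apply/double_sectorE => //; split => //.
by apply: h; rewrite ltr_pM2r.
Qed.

End DoubleSector.

(** * The S-resolvent *)

Section SResolvent.
Context {R : realType} {d : nat} {VR : hilbertType R}.
Local Notation V := (hmodule d VR).
Implicit Types (T : operator V) (s : paravector R d) (B : V -> V).

Lemma right_linear_scale T a v : right_linear T -> dom T v ->
  dom T (a *: v) /\ T (a *: v) = a *: T v.
Proof. by move=> [_ _ Tm] /(Tm _ (a *: 1)); rewrite !rmulc_scalar. Qed.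

Lemma right_linear_sub T v w : right_linear T -> dom T v -> dom T w ->
  dom T (v - w) /\ T (v - w) = T v - T w.
Proof.
move=> Tl Dv /(right_linear_scale (-1) Tl)[]; rewrite scaleN1r => Dw Tw.
by have [_ TD _] := Tl; have [? ->] := TD _ _ Dv Dw; rewrite Tw scaleN1r.
Qed.

(** The everywhere defined inverse of Q_s[T] as a plain function, which spares
    the domain and choice that opinv carries. *)
Definition is_Qinv s T B : Prop :=
  [/\ linear B, forall v a, B (rmulc v a) = rmulc (B v) a,
      forall v, dom (Qop s T) (B v) /\ Qop s T (B v) = v &
      forall v, dom (Qop s T) v -> B (Qop s T v) = v].

Lemma opinv_eq s T B : is_Qinv s T B -> opinv (Qop s T) =1 B.
Proof.
move=> [_ _ BQ QB] v; rewrite /=; have [DB QBv] := BQ v.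
case: xgetP => [w _ [Dw Qw]|/(_ (B v))[]//]; rewrite -(QB _ Dw).
by congr (B _).
Qed.

Lemma dom_opinv s T B v : is_Qinv s T B -> dom (opinv (Qop s T)) v.
Proof. by move=> [_ _ BQ _]; have [DB QBv] := BQ v; exists (B v). Qed.

Lemma resolvent_set_Qinv s T : right_linear T -> S_resolvent_set T s ->
  exists B M, is_Qinv s T B /\ forall v, `|B v| <= M * `|v|.
Proof.
move=> Tl [Qinj [Bl Bdom /opnorm_lty_ex[M BM]]].
have Dall v : dom (opinv (Qop s T)) v by rewrite Bdom.
have QB v : dom (Qop s T) (opinv (Qop s T) v) /\ Qop s T (opinv (Qop s T) v) = v.
  have [w Dw Qw] := Dall v; rewrite /=; case: xgetP => [u _ []//|/(_ w)[]].
  by split.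
have BZ a v := right_linear_scale a Bl (Dall v).
exists (opinv (Qop s T)), M; split; last first.
  by move=> v; apply: norm_le_of_opnorm.
split => [a v w|v a|v|v Dv].
- have [_ BD _] := Bl; have [_ ->] := BD (a *: v) w (Dall _) (Dall _).
  by have [_ ->] := BZ a v.
- by have [_ _ Bm] := Bl; have [] := Bm v a (Dall v).
- exact: QB.
- by have [DB QBv] := QB (Qop s T v); apply: Qinj.
Qed.

Lemma Qinv_resolvent_set s T B M :
  is_Qinv s T B -> (forall v, `|B v| <= M * `|v|) -> S_resolvent_set T s.
Proof.
move=> BQ BM; have [Blin Bm QB BQv] := BQ.
have M0 : 0 <= Num.max M 0 by rewrite le_max lexx orbT.
have Beq := opinv_eq BQ; have Dall v := dom_opinv v BQ.
split; first by move=> v w Dv Dw e; rewrite -(BQv _ Dv) e BQv.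
split; last first.
- apply: (@le_lt_trans _ _ (Num.max M 0)%:E); last exact: ltry.
  apply: opnorm_le => // v _; rewrite Beq (le_trans (BM v))//.
  by rewrite ler_wpM2r// le_max lexx.
- by apply/seteqP; split => v.
split => // [v w _ _|v a _]; split => //; rewrite !Beq.
  by have := Blin 1 v w; rewrite !scale1r.
exact: Bm.
Qed.

End SResolvent.

Section SplitBounds.
Context {R : realType} {d : nat} {VR : hilbertType R}.
Local Notation V := (hmodule d VR).
Implicit Types (T : operator V) (s : paravector R d) (B : V -> V).

Lemma Qop_conj s T : Qop (para_conj s) T = Qop s T.
Proof. by rewrite /Qop para_conj_re para_conj_abs. Qed.

Lemma double_sector_conj phi s :
  (double_sector phi `|` [set 0]) (para_conj s) ->
  (double_sector phi `|` [set 0]) s.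
Proof.
have conj0 : (para_conj s == 0) = (s == 0).
  by rewrite -!para_abs_eq0 para_conj_abs.
rewrite /double_sector /= /Arg para_conj_re para_conj_abs.
case=> [[h ?]|/eqP h]; first by left; split => //; rewrite -conj0.
by right; apply/eqP; rewrite -conj0.
Qed.

(** The splitting of the resolvent along s = s_0 + x; the formula at the
    conjugate of s differs in the sign of the middle term only. *)
Lemma left_S_resolventE s T B v : is_Qinv s T B ->
  dom (left_S_resolvent s T) v /\
  left_S_resolvent s T v =
    s 0 ord0 *: B v - B (lmulc (paravec s) v) - T (B v).
Proof.
move=> BQ; have Beq := opinv_eq BQ.
have Bdom w := dom_opinv w BQ; have [Blin _ QB _] := BQ; split.
  split; first exact: Bdom.
  split; first exact: Bdom.
  by rewrite Beq; have [[]] := QB v.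
have -> : left_S_resolvent s T v = opinv (Qop s T) (lmulc (cconj (para s)) v)
  - T (opinv (Qop s T) v) by [].
rewrite !Beq cconj_para lmulcB lmulc_scalar (GRing.zmod_morphism_linear Blin).
by congr (_ - _ - _); exact: (GRing.scalable_linear Blin).
Qed.

(** The half sum and half difference of the left S-resolvents at s and at its
    conjugate are s_0 B - T B and v |-> - B (x v).  The bound for B (x v) becomes
    one for B on replacing v by x v, because x^2 = - |x|^2. *)
Lemma Qinv_split_bounds T s phi C B :
  right_linear T -> 0 <= C ->
  (forall t, ~ (double_sector phi `|` [set 0]) t ->
     (opnorm (left_S_resolvent t T) <= (C / cabs (para t))%:E)%E) ->
  ~ (double_sector phi `|` [set 0]) s -> is_Qinv s T B ->
  forall v, `|s 0 ord0 *: B v - T (B v)| <= C / cabs (para s) * `|v| /\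
    paravec_abs s * `|B v| <= C / cabs (para s) * `|v|.
Proof.
move=> Tl C0 TC sphi BQ.
have [Blin Bm QB BQv] := BQ.
set c := C / cabs (para s); set x := paravec s.
have BZ a v : B (a *: v) = a *: B v by exact: (GRing.scalable_linear Blin).
have BN v : B (- v) = - B v by rewrite -scaleN1r BZ scaleN1r.
have TB_linear a v : T (B (a *: v)) = a *: T (B v).
  by rewrite BZ; have [[Dv _] _] := QB v; have [] := right_linear_scale a Tl Dv.
have bound t (tQ : is_Qinv t T B) : ~ (double_sector phi `|` [set 0]) t ->
    forall v, `|t 0 ord0 *: B v - B (lmulc (paravec t) v) - T (B v)| <=
      C / cabs (para t) * `|v|.
  move=> tphi v; have [Dv <-] := left_S_resolventE v tQ.
  apply: norm_le_of_opnorm Dv; first exact: TC.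
  move=> a u _; have [Du ->] := left_S_resolventE u tQ.
  have [Dau ->] := left_S_resolventE (a *: u) tQ; split => //.
  rewrite TB_linear linearZ/= !BZ !scalerBr !scalerA.
  by rewrite [a * t 0 ord0]mulrC.
have conjQ : is_Qinv (para_conj s) T B by rewrite /is_Qinv Qop_conj.
have b1 v := bound _ BQ sphi v.
have b2 v := bound _ conjQ (fun h => sphi (double_sector_conj h)) v.
have {}b1 v : `|(s 0 ord0 *: B v - T (B v)) - B (lmulc x v)| <= c * `|v|.
  by rewrite addrAC; exact: b1.
have {}b2 v : `|(s 0 ord0 *: B v - T (B v)) + B (lmulc x v)| <= c * `|v|.
  have := b2 v; rewrite para_conj_re para_conj_abs paravec_conj -/x lmulcN BN opprK.
  by rewrite addrAC.
move=> v; have [h1 _] := norm_le_half_sums (b1 v) (b2 v); split => //.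
have [->|q0] := eqVneq (paravec_abs s) 0.
  by rewrite mul0r mulr_ge0// divr_ge0// sqrtr_ge0.
have [_] := norm_le_half_sums (b1 (lmulc x v)) (b2 (lmulc x v)).
rewrite lmulcA paravec_sqr lmulc_scalar BZ normrZ norm_lmulc_paravec normrN.
have qp : 0 < paravec_abs s by rewrite lt_def q0 sqrtr_ge0.
rewrite ger0_norm ?exprn_ge0 ?(ltW qp)// expr2 -mulrA.
by rewrite [c * _]mulrCA ler_pM2l.
Qed.

End SplitBounds.

(** * The adjoint *)

Section Adjoint.
Context {R : realType} {d : nat} {VR : hilbertType R}.
Local Notation V := (hmodule d VR).
Implicit Types (T : operator V) (s : paravector R d) (B : V -> V).

(** For a right-linear T, dom(T) is stable by right multiplication, so the real
    identity at all v a yields every component of the Clifford identity at v. *)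
Lemma cinner_adjP T w z : right_linear T ->
  (forall v, dom T v -> cinner z v = cinner w (T v)) <->
  (forall v, dom T v -> inner z v = inner w (T v)).
Proof.
move=> [_ _ Tm]; split=> zw v Dv.
  have /ffunP/(_ finset.set0) := zw v Dv; rewrite !cinner_coord.
  have -> : cconj (cbasis R finset.set0) = 1 *: 1 :> clifford R d.
    by rewrite cconj_basis /swaps big_set0 expr0.
  by rewrite !rmulc_scalar !scale1r.
apply/ffunP => A; rewrite !cinner_coord.
by have [Da <-] := Tm v (cconj (cbasis R A)) Dv; exact: zw.
Qed.

Context (T : operator V) (Tl : right_linear T) (Td : dense (dom T)).

Lemma adjoint_inner w : dom (adjoint T) w ->
  forall v, dom T v -> inner (adjoint T w) v = inner w (T v).
Proof.
move=> [z zw]; apply/cinner_adjP => //; rewrite /=.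
by case: xgetP => [u _ //|/(_ z)/(_ zw)].
Qed.

Lemma adjoint_intro w z : (forall v, dom T v -> inner z v = inner w (T v)) ->
  dom (adjoint T) w /\ adjoint T w = z.
Proof.
move=> zw; have Dw : dom (adjoint T) w by exists z; exact/cinner_adjP.
split => //; apply/subr0_eq; apply: (dense_inner_eq0 Td) => v Dv.
by rewrite innerDl innerNl zw// adjoint_inner// subrr.
Qed.

Lemma adjoint_right_linear : right_linear (adjoint T).
Proof.
split => [|v w Dv Dw|w a Dw].
- by have [] := @adjoint_intro 0 0 (fun v _ => etrans (inner0l v) (esym (inner0l _))).
- by apply: adjoint_intro => u Du; rewrite !innerDl !adjoint_inner.
apply: adjoint_intro => v Dv; rewrite !inner_rmulc.
have [_ _ Tm] := Tl; have [Da Ta] := Tm v (cconj a) Dv.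
by rewrite -Ta adjoint_inner.
Qed.

Lemma adjoint_closed : closed_operator (adjoint T).
Proof.
split; first exact: adjoint_right_linear.
have -> : [set p : V * V | dom (adjoint T) p.1 /\ adjoint T p.1 = p.2] =
    \bigcap_(v in dom T) [set p : V * V | inner p.2 v - inner p.1 (T v) = 0].
  apply/seteqP; split => [[w z] /= [Dw <-] v Dv|[w z] zw].
    by rewrite /= adjoint_inner// subrr.
  by apply: adjoint_intro => v /zw /subr0_eq.
apply: closed_bigI => v Dv.
apply: (@preimage_closed _ _ (fun p : V * V => inner p.2 v - inner p.1 (T v)) [set 0]).
  move=> p _.
  have p1 : (fun q : V * V => q.1) @ p --> p.1 by apply: cvg_fst.
  have p2 : (fun q : V * V => q.2) @ p --> p.2 by apply: cvg_snd.
  exact: (cvgB (cvg_inner p2) (cvg_inner p1)).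
exact: closed_eq.
Qed.

(** B maps into dom(T^2) and commutes with T on dom(T).  Hence, for v in dom(T),
      <A w, T v> = <w, T B v> = <N w, v>,
      <N w, T v> = <w, T T B v> = <w + 2 s_0 N w - |s|^2 A w, v>,
    which put A w and N w in dom(T^* ) and compute Q_s[T^*] A = 1.  The other
    identity A Q_s[T^*] = 1 is the adjoint of Q_s[T] B = 1. *)
Lemma Qinv_adjoint s B A N : is_Qinv s T B ->
  (forall x y, inner (A x) y = inner x (B y)) ->
  (forall x y, inner (N x) y = inner x (T (B y))) ->
  is_Qinv s (adjoint T) A /\ forall w, adjoint T (A w) = N w.
Proof.
move=> BQ AB NTB; have [Blin Bm QB BQv] := BQ.
have QBE v : T (T (B v)) =
    v + (2 * s 0 ord0) *: T (B v) - cabs (para s) ^+ 2 *: B v.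
  have [_ /= QBv] := QB v.
  by rewrite -[X in _ = X + _ - _]QBv addrAC addrK subrK.
have comm v : dom T v -> dom T (T (B v)) /\ dom T (T (T (B v))) /\ B (T v) = T (B v).
  move=> Dv; have [[/= DB DTB] QBv] := QB v; split => //.
  have [_ TD _] := Tl.
  have [D1 T1] := right_linear_scale (2 * s 0 ord0) Tl DTB.
  have [D2 T2] := right_linear_scale (cabs (para s) ^+ 2) Tl DB.
  have [D3 T3] := TD _ _ Dv D1.
  have [D4 T4] := right_linear_sub Tl D3 D2.
  (* Applying T to T^2 B v = v + 2 s_0 T B v - |s|^2 B v shows that T B v lies in
     dom(T^2) and that Q_s[T] T B v = T v. *)
  have TTT : T (T (T (B v))) = T v + (2 * s 0 ord0) *: T (T (B v))
      - cabs (para s) ^+ 2 *: T (B v) by rewrite [in LHS]QBE T4 T3 T1 T2.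
  split; first by rewrite QBE.
  rewrite -[RHS](BQv (T (B v))); last by split => //=; rewrite QBE.
  by congr (B _); rewrite /= TTT addrAC subrK addrK.
have adjA w : dom (adjoint T) (A w) /\ adjoint T (A w) = N w.
  apply: adjoint_intro => v Dv; rewrite AB NTB.
  by have [_ [_ ->]] := comm v Dv.
have adjN w : dom (adjoint T) (N w) /\ adjoint T (N w) =
    w + (2 * s 0 ord0) *: N w - cabs (para s) ^+ 2 *: A w.
  apply: adjoint_intro => v Dv; rewrite NTB.
  have [_ [_ ->]] := comm v Dv.
  by rewrite QBE !(innerDl, innerDr, innerNl, innerNr, innerZl, innerZr) AB NTB.
have N_eq w : adjoint T (A w) = N w by have [] := adjA w.
split => //; split.
- exact: adjoint_linear AB.
- by move=> v a; apply: inner_eql => u; rewrite AB !inner_rmulc AB Bm.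
- move=> w; have [DA TA] := adjA w; have [DN TN] := adjN w.
  have DTA : dom (adjoint T) (adjoint T (A w)) by rewrite TA.
  split; first by split.
  have -> : Qop s (adjoint T) (A w) = adjoint T (adjoint T (A w)) -
    (2 * s 0 ord0) *: adjoint T (A w) + cabs (para s) ^+ 2 *: A w by [].
  by rewrite TA TN addrAC addrNK addrK.
move=> w [Dw DTw]; apply: inner_eql => v.
have [[DB DTB] QBv] := QB v.
have -> : Qop s (adjoint T) w = adjoint T (adjoint T w) -
    (2 * s 0 ord0) *: adjoint T w + cabs (para s) ^+ 2 *: w by [].
rewrite AB -[in RHS]QBv /= !(innerDl, innerDr, innerNl, innerNr, innerZl, innerZr).
by rewrite !adjoint_inner.
Qed.

End Adjoint.

(** * Bisectorial operators *)

Section Bisectorial.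
Context {R : realType} {d : nat} {VR : hilbertType R}.
Local Notation V := (hmodule d VR).
Implicit Types (T : operator V) (s : paravector R d).

(** Points outside D_phi are outside the closure of D_omega, hence in the
    S-resolvent set. *)
Lemma bisectorial_Qinv T omega phi C s :
  0 < omega < pi / 2 -> bisectorial omega T -> omega < phi < pi / 2 -> 0 <= C ->
  (forall t, ~ (double_sector phi `|` [set 0]) t ->
     (opnorm (left_S_resolvent t T) <= (C / cabs (para t))%:E)%E) ->
  ~ (double_sector phi `|` [set 0]) s ->
  exists B M, [/\ is_Qinv s T B, forall v, `|B v| <= M * `|v| &
    forall v, `|s 0 ord0 *: B v - T (B v)| <= C / cabs (para s) * `|v| /\
      paravec_abs s * `|B v| <= C / cabs (para s) * `|v|].
Proof.
move=> omegaP [[Tl _] spec _] phiP C0 TC sphi.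
have sres : S_resolvent_set T s.
  by apply: contrapT => /spec; exact: (sector_disjoint omegaP phiP).
have [B [M [BQ BM]]] := resolvent_set_Qinv Tl sres.
by exists B, M; split => //; exact: (Qinv_split_bounds Tl C0 TC sphi BQ).
Qed.

(** A generator e_i gives the purely imaginary points s = n e_i, for which
    Q_s[T] = T^2 + n^2, so that v = T (T B v) + n^2 B v. *)
Lemma bisectorial_dense T omega : (0 < d)%N ->
  0 < omega < pi / 2 -> bisectorial omega T -> dense (dom T).
Proof.
move=> d_gt0 omegaP bis; pose i0 : 'I_d := Ordinal d_gt0.
have [[Tl Tclosed] spec est] := bis.
have /andP[om0 om2] := omegaP.
(* Any angle strictly between omega and pi / 2 would do. *)
pose phi := (omega + pi / 2) / 2.
have phiP : omega < phi < pi / 2.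
  by rewrite /phi; move: om2; move: (pi / 2 : R) => p ?; apply/andP; split; lra.
have phiP' : 0 < phi < pi / 2.
  by have /andP[h ->] := phiP; rewrite (lt_trans om0).
have [C C0 TC] := est phi phiP.
have [T0 TD _] := Tl.
apply: (@dense_dom_of_vanishing_preimages _ _ T C) => //.
  by move=> a v; exact: right_linear_scale.
move=> n x; pose s : paravector R d := n.+1%:R *: delta_mx 0 (lift ord0 i0).
have s0 : s 0 ord0 = 0 by rewrite !mxE mulr0.
have sq : paravec_abs s = n.+1%:R.
  rewrite /paravec_abs (bigD1 i0)//= big1 ?addr0 ?mxE ?eqxx ?mulr1.
    by rewrite sqrtr_sqr ger0_norm.
  move=> i /negPf ii0; rewrite !mxE (inj_eq lift_inj) ii0 andbF.
  by rewrite mulr0 expr0n.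
have sabs : cabs (para s) = n.+1%:R.
  apply/eqP; rewrite -(@eqrXn2 _ 2) ?sqrtr_ge0//.
  by rewrite para_abs_sqr s0 sq expr0n add0r.
have sphi : ~ (double_sector phi `|` [set 0]) s.
  case=> [/(double_sectorE _ phiP')[_]|/= se].
    rewrite s0 sabs normr0; have /andP[c0 _] := cos_bounds phiP'.
    by rewrite pmulr_llt0// ltNge (ltW c0).
  by move/eqP: se; rewrite -para_abs_eq0 sabs pnatr_eq0.
have [B [M [BQ BM bounds]]] := bisectorial_Qinv omegaP bis phiP C0 TC sphi.
have [_ _ QB _] := BQ; have [[/= DB DTB]] := QB x.
rewrite s0 sabs mulr0 scale0r subr0 => QBx.
have [b1 b2] := bounds x.
have n0 : 0 < n.+1%:R :> R by [].
exists (T (B x)), (n.+1%:R ^+ 2 *: B x); split => //.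
- by have [] := right_linear_scale (n.+1%:R ^+ 2) Tl DB.
- by rewrite -[X in _ = X - _]QBx addrK.
- move: b1; rewrite s0 scale0r sub0r normrN sabs.
  by rewrite mulrAC ler_pdivlMr// mulrC.
- move: b2; rewrite sq sabs normrZ ger0_norm ?exprn_ge0//.
  by rewrite [C / _ * _]mulrAC ler_pdivlMr// expr2 mulrAC.
Qed.

(** The constant at the angle phi doubles: the two parts s_0 B - T B and x B of
    the adjoint S-resolvent are each bounded by C / |s|. *)
Lemma bisectorial_adjoint T omega : 0 < omega < pi / 2 ->
  dense (dom T) -> bisectorial omega T -> bisectorial omega (adjoint T).
Proof.
move=> omegaP Td bis; have [[Tl Tclosed] spec est] := bis.
have Qadj phi C s : omega < phi < pi / 2 -> 0 <= C ->
    (forall t, ~ (double_sector phi `|` [set 0]) t ->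
      (opnorm (left_S_resolvent t T) <= (C / cabs (para t))%:E)%E) ->
    ~ (double_sector phi `|` [set 0]) s ->
    S_resolvent_set (adjoint T) s /\
    (opnorm (left_S_resolvent s (adjoint T)) <= (2 * C / cabs (para s))%:E)%E.
  move=> phiP C0 TC sphi.
  have [B [M [BQ BM bounds]]] := bisectorial_Qinv omegaP bis phiP C0 TC sphi.
  have [Blin Bm QB BQv] := BQ.
  set c := C / cabs (para s) in bounds.
  have c0 : 0 <= c by rewrite divr_ge0// sqrtr_ge0.
  have TBlin : linear (T \o B).
    move=> a u v /=; rewrite Blin; have [[Du _] _] := QB u.
    have [[Dv _] _] := QB v; have [Dau Tau] := right_linear_scale a Tl Du.
    by have [_ TD _] := Tl; have [_ ->] := TD _ _ Dau Dv; rewrite Tau.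
  have TBM v : `|(T \o B) v| <= (`|s 0 ord0| * M + c) * `|v|.
    have [b1 _] := bounds v; rewrite mulrDl -mulrA.
    have -> : (T \o B) v = s 0 ord0 *: B v - (s 0 ord0 *: B v - T (B v)).
      by rewrite opprB addrC subrK.
    apply: (le_trans (ler_normB _ _)); rewrite lerD// normrZ ler_wpM2l//.
  have [A AB] := bounded_adjoint Blin BM.
  have [N NTB] := bounded_adjoint TBlin TBM.
  have [AQ TA] := Qinv_adjoint Tl Td BQ AB NTB.
  split; first exact: (Qinv_resolvent_set AQ (adjoint_norm_le AB BM)).
  apply: opnorm_le; first by rewrite -mulrA mulr_ge0.
  move=> v _; have [_ ->] := left_S_resolventE v AQ.
  rewrite TA.
  (* The left S-resolvent of T^* at s is the adjoint of s B - T B. *)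
  apply: (@adjoint_norm_le _ _
    (fun w => s 0 ord0 *: A w - A (lmulc (paravec s) w) - N w)
    (fun y => s 0 ord0 *: B y + lmulc (paravec s) (B y) - T (B y))).
    move=> x y.
    rewrite !(innerDl, innerDr, innerNl, innerNr, innerZl, innerZr) !AB NTB /=.
    by rewrite inner_lmulc cconj_paravec lmulcN innerNr opprK.
  move=> y; have [b1 b2] := bounds y; rewrite addrAC.
  apply: (le_trans (ler_normD _ _)); rewrite norm_lmulc_paravec.
  have -> : 2 * C / cabs (para s) = c + c by rewrite -mulrA mulr_natl mulr2n.
  by rewrite mulrDl lerD.
split; first exact: adjoint_closed.
- move=> s sspec; apply: contrapT => /(sector_escape omegaP)[phi phiP sphi].
  apply: sspec; have [C C0 TC] := est phi phiP.
  by have [] := Qadj phi C s phiP C0 TC sphi.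
move=> phi phiP; have [C C0 TC] := est phi phiP.
exists (2 * C); first by rewrite mulr_ge0.
by move=> s sphi; have [] := Qadj phi C s phiP C0 TC sphi.
Qed.

End Bisectorial.

Unset Implicit Arguments.
Set Strict Implicit.
Set Printing Implicit Defensive.

Theorem lemma4p11 (R : realType) (d : nat) (hd : (1 <= d)%N)
    (VR : hilbertType R) (T : operator (hmodule d VR)) (omega : R)
    (homega : 0 < omega < pi / 2)
    (hT : bisectorial omega T) :
  [/\ dense (dom T), closed_operator (adjoint T) &
      bisectorial omega (adjoint T)].
Proof.
have Td := bisectorial_dense hd homega hT.
have aT := bisectorial_adjoint homega Td hT.
by split => //; have [] := aT.
Qed.
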